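(* Let $\Delta>0$ be an integer that is not a perfect square, consider an orbit under $\mathcal T$ of good points of $H=H_\Delta$, and let $T$ be the operator defining the cycle of this orbit in $H^0$. Then $T$ is the product of $t=t_A+t_B$ operators, $t_A$ of type $A$ and $t_B$ of type $B$, if and only if: (1) in $H_A$ and in $H_{\bar A}$, as well as in every domain in $G_A$ and $G_{\bar A}$, there are $t_B$ points of the orbit; and (2) in $H_B$ and in $H_{\bar B}$, as well as in every domain in $G_B$ and $G_{\bar B}$, there are $t_A$ points of the orbit.
   Context: A form $f=mx^2+ny^2+kxy$ with integer coefficients is identified with $\mathbf f=(m,n,k)\in\mathbb Z^3$, called a good point; put $K=k$, $D=m-n$, $S=m+n$; the discriminant is $\Delta=k^2-4mn=K^2+D^2-S^2$ and $H=H_\Delta=\{K^2+D^2-S^2=\Delta\}\subset\mathbb R^3$. For $L\in\mathrm{SL}(2,\mathbb Z)$, $T_L$ sends $f$ to $f'$ with $f'(v)=f(Lv)$; $\mathcal T=\{T_L\}$; orbits are orbits of good points under $\mathcal T$. $A(m,n,k)=(m,m+n+k,k+2m)$, $B(m,n,k)=(m+n+k,n,k+2n)$, $\bar A=A^{-1}$, $\bar B=B^{-1}$. Subsets of $H$: $H^0=\{|S|<|D|,D>0\}$, $H^0_R=\{|S|<|D|,D<0\}$; $G_A=\{S>|D|,K>0\}$, $G_{\bar A}=\{S>|D|,K<0\}$, $G_B=\{S<-|D|,K<0\}$, $G_{\bar B}=\{S<-|D|,K>0\}$; $H_A=\{|D|<|S|<|K|,S>0,K>0\}$, $H_{\bar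 A}=\{|D|<|S|<|K|,S>0,K<0\}$, $H_B=\{|D|<|S|<|K|,S<0,K<0\}$, $H_{\bar B}=\{|D|<|S|<|K|,S<0,K>0\}$. Cycle: a cycle of length $t>1$ is a sequence of points $[\mathbf f_1,\dots,\mathbf f_t]$, traversed once (distinct points), with $\mathbf f_i=T_{i-1}\mathbf f_{i-1}$ ($i=2,\dots,t$) and $\mathbf f_1=T_t\mathbf f_t$, each $T_i$ being $A$ or $B$; sequences differing by a cyclic shift are the same cycle. Each orbit of good points (for $\Delta$ not a square) contains exactly one cycle in $H^0$; the operator defining it is $T=T_tT_{t-1}\cdots T_1$ (a cyclic shift does not change the numbers of factors $A$ and $B$). Domains: rational numbers have generations: $0/1$ and $1/0$ have generation zero; for $n\ge1$ the positive rationals of generation $n$ are obtained from $1/1$ by applying all words of length $n-1$ in $x\mapsto x+1$ and $x\mapsto x/(x+1)$; a negative rational has the generation of its absolute value. For $x=p/q$ in lowest terms the rhombus $H^{x}$ is $\{(K,D,S)\in H:(p^2+q^2)|S|<2pqK+(q^2-p^2)D\}$ (a rotation of $H^0$ about the $S$-axis). $H^{\mathbf n}$ is the union of the rhombi of generation $n$; $\mathcal H^{\mathbf 0}=H^0\cup H^0_R$ and, for $n\ge1$, $\mathcal H^{\mathbf n}=H^{\mathbf n}\setminus(\overline{H^{\mathbf 0}}\cup\dots\cup\overline{H^{\mathbf{n-1}}})$, closures in $H$. ''A domain in $G_A$'' (resp. $G_{\bar A},G_B,G_{\bar B}$) means a connected component, contained in $G_A$ (resp. $G_{\bar A},G_B,G_{\bar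 B}$), of some $\mathcal H^{\mathbf r}$ with $r\ge1$. *)

(* Defs.v *)
From HB Require Import structures.
From mathcomp Require Import all_boot all_order all_algebra.
From mathcomp Require Import all_classical all_reals all_analysis.

Set Implicit Arguments.
Unset Strict Implicit.
Unset Printing Implicit Defensive.

Import Order.TTheory GRing.Theory Num.Theory.
Import numFieldNormedType.Exports.

Local Open Scope classical_set_scope.
Local Open Scope ring_scope.

(* The triple (m, n, k) stands for the form m x^2 + n y^2 + k x y. *)
Definition good_point : Type := (int * int * int)%type.

Definition form_eval (f : good_point) (v : 'cV[int]_2) : int :=
  let: (m, n, k) := f in
  let x := v ord0 ord0 in
  let y := v ord_max ord0 in
  m * x ^+ 2 + n * y ^+ 2 + k * x * y.

Definition disc (f : good_point) : int :=
  let: (m, n, k) := f in k ^+ 2 - 4 * m * n.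

(* g = T_L f; this determines g, since a form is determined by its values. *)
Definition is_transform (L : 'M[int]_2) (f g : good_point) : Prop :=
  forall v : 'cV[int]_2, form_eval g v = form_eval f (L *m v).

Definition orbit_of (f : good_point) : set good_point :=
  [set g | exists2 L : 'M[int]_2, \det L = 1 & is_transform L f g].

Definition is_orbit (Delta : int) (O : set good_point) : Prop :=
  exists2 f : good_point, disc f = Delta & O = orbit_of f.

Definition opA (f : good_point) : good_point :=
  let: (m, n, k) := f in (m, m + n + k, k + 2 * m).

Definition opB (f : good_point) : good_point :=
  let: (m, n, k) := f in (m + n + k, n, k + 2 * n).

Inductive letter := LA | LB.

Definition is_A (l : letter) : bool := if l is LA then true else false.
Definition is_B (l : letter) : bool := if l is LB then true else false.

Definition letter_op (l : letter) : good_point -> good_point :=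
  if l is LA then opA else opB.

(* For w = [:: l_1; ...; l_t] this is the composite T_t o ... o T_1: the first
   letter acts first. *)
Definition word_op (w : seq letter) (f : good_point) : good_point :=
  foldl (fun g l => letter_op l g) f w.

Definition is_product (tA tB : nat) (T : good_point -> good_point) : Prop :=
  exists w : seq letter, [/\ count is_A w = tA, count is_B w = tB & T =1 word_op w].

(* ordS is the cyclic successor on 'I_t, so the last equation closes the
   cycle. *)
Definition is_cycle (t : nat) (f : 'I_t -> good_point) (w : t.-tuple letter) : Prop :=
  [/\ (1 < t)%N, injective f &
      forall i : 'I_t, f (ordS i) = letter_op (tnth w i) (f i)].

Section Geometry.
Variable R : realType.

(* A point of R^3 is given by its coordinates (K, D, S), in this order. *)
Notation R3 := (R * R * R)%type.

Definition coordK (P : R3) : R := P.1.1.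
Definition coordD (P : R3) : R := P.1.2.
Definition coordS (P : R3) : R := P.2.

Definition embed (f : good_point) : R3 :=
  let: (m, n, k) := f in (k%:~R, (m - n)%:~R, (m + n)%:~R).

Variable Delta : int.

Definition hyperboloid : set R3 :=
  [set P | coordK P ^+ 2 + coordD P ^+ 2 - coordS P ^+ 2 = Delta%:~R].

Definition H0 : set R3 :=
  hyperboloid `&` [set P | `|coordS P| < `|coordD P| /\ 0 < coordD P].

Definition G_A : set R3 :=
  hyperboloid `&` [set P | `|coordD P| < coordS P /\ 0 < coordK P].
Definition G_Abar : set R3 :=
  hyperboloid `&` [set P | `|coordD P| < coordS P /\ coordK P < 0].
Definition G_B : set R3 :=
  hyperboloid `&` [set P | coordS P < - `|coordD P| /\ coordK P < 0].
Definition G_Bbar : set R3 :=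
  hyperboloid `&` [set P | coordS P < - `|coordD P| /\ 0 < coordK P].

Definition H_outer : set R3 :=
  hyperboloid `&`
  [set P | `|coordD P| < `|coordS P| /\ `|coordS P| < `|coordK P|].

Definition H_A : set R3 :=
  H_outer `&` [set P | 0 < coordS P /\ 0 < coordK P].
Definition H_Abar : set R3 :=
  H_outer `&` [set P | 0 < coordS P /\ coordK P < 0].
Definition H_B : set R3 :=
  H_outer `&` [set P | coordS P < 0 /\ coordK P < 0].
Definition H_Bbar : set R3 :=
  H_outer `&` [set P | coordS P < 0 /\ 0 < coordK P].

Definition rhombus (p q : int) : set R3 :=
  hyperboloid `&`
  [set P | (p ^+ 2 + q ^+ 2)%:~R * `|coordS P| <
           (2 * p * q)%:~R * coordK P + (q ^+ 2 - p ^+ 2)%:~R * coordD P].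

Inductive pos_generation : nat -> rat -> Prop :=
| pos_generation1 : pos_generation 1 1
| pos_generationD n x : pos_generation n x -> pos_generation n.+1 (x + 1)
| pos_generationV n x : pos_generation n x -> pos_generation n.+1 (x / (x + 1)).

(* The fraction p/q, in lowest terms, has generation n; fractions are pairs
   because 1/0 is allowed in generation zero. *)
Definition has_generation (n : nat) (p q : int) : Prop :=
  if n is 0%N then (p = 0 /\ q = 1) \/ (p = 1 /\ q = 0)
  else exists x : rat, [/\ pos_generation n `|x|, p = numq x & q = denq x].

Definition Hgen (n : nat) : set R3 :=
  [set P | exists p q : int, has_generation n p q /\ rhombus p q P].

Definition closure_in_H (X : set R3) : set R3 := hyperboloid `&` closure X.

(* For n = 0 nothing is removed, and this is H^0 together with H^0_R. *)
Definition calH (n : nat) : set R3 :=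
  Hgen n `\` \bigcup_(j in [set j | (j < n)%N]) closure_in_H (Hgen j).

Definition is_domain_in (G C : set R3) : Prop :=
  C `<=` G /\
  exists r : nat, exists P : R3,
    [/\ (1 <= r)%N, calH r P & C = connected_component (calH r) P].

Definition has_points (O : set good_point) (C : set R3) (N : nat) : Prop :=
  ([set f | O f /\ C (embed f)] #= `I_N)%card.

(* t is the length of a cycle of O in H^0, and T the operator defining it. *)
Definition cycle_operator (O : set good_point) (t : nat)
    (T : good_point -> good_point) : Prop :=
  exists (f : 'I_t -> good_point) (w : t.-tuple letter),
    [/\ is_cycle f w, (forall i, O (f i)), (forall i, H0 (embed (f i)))
      & T =1 word_op w].

End Geometry.

Arguments H_A R Delta : clear implicits.
Arguments H_Abar R Delta : clear implicits.
Arguments H_B R Delta : clear implicits.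
Arguments H_Bbar R Delta : clear implicits.
Arguments G_A R Delta : clear implicits.
Arguments G_Abar R Delta : clear implicits.
Arguments G_B R Delta : clear implicits.
Arguments G_Bbar R Delta : clear implicits.

(* Main.v *)
Require Import Defs.
From mathcomp Require Import all_boot all_order all_algebra.
From mathcomp Require Import all_classical all_reals all_analysis.
From mathcomp Require Import zify ring lra.
Import Order.TTheory GRing.Theory Num.Theory.
Import numFieldNormedType.Exports.
Local Open Scope classical_set_scope.
Local Open Scope ring_scope.

(** A form of positive discriminant is indefinite: it is positive on the lines
    of one open arc of the projective line and negative on those of the
    complementary arc.  In these terms H^0 consists of the forms that are
    positive at (1,0) and negative at (0,1), the rhombus of p/q of those that
    are positive at (q,p) and negative at (-p,q), and G_A of those whose
    negative arc lies strictly inside the second quadrant.  On G_A the rhombus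
    of x > 0 is therefore the condition that the direction (-x,1) be negative.

    The cycle is all of H^0.  On a form of H^0 exactly one of A and B stays in
    H^0, according to the sign of f(1,1) (which is not zero as the discriminant
    is not a square).  If f and f o L are both in H^0, the signs of the entries
    of L are restricted: up to a global sign, either L or its inverse has
    nonnegative entries, because f changes sign only once in each quadrant.  A
    nonnegative matrix of determinant one is a product of the matrices of A and
    B, and f forces each factor; hence f and f o L lie on one trajectory
    ([straddling_orbit_mem], [cycle_traverses]).

    H_A counts the B-steps.  A point (m,n,k) of H_A has m, n > 0 and
    m + n - k < 0, so its inverse image under A is in H^0; as A leads that
    point out of H^0, the cycle continues from it with B.  Conversely A takes
    each point of the cycle that is followed by B into H_A ([H_A_count]).

    Domains of G_A are copies of H_A.  A and B map G_A into itself and act on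
    the directions -1/x as x -> x + 1 and x -> x / (x + 1), the two maps that
    create the generations.  Consequently the part of the r-th layer that lies
    in G_A is the disjoint union of the images of H_A under the 2^(r-1) words
    of length r - 1 ([calH_G_A]).  These cells are open in H and connected, so
    they are the components ([domain_cell]), and an invariant set of integral
    points meets all of them equally often ([has_points_cell]).

    The quarter turn f(y,-x) belongs to the group and exchanges G_A with the
    region of the inverse of A; the map sending f to -f(y,x) exchanges A with B
    and G_A with G_B.  Both preserve generations, which gives the remaining
    regions ([upper_counts], [lower_counts]).  Finally the numbers of letters
    are determined by T, as A and B generate a free monoid ([word_op_inj]). *)

(** * Substitutions and orbits *)

Definition subst_form (a b c d : int) (f : good_point) : good_point :=
  let: (m, n, k) := f in
  (m * a ^+ 2 + n * c ^+ 2 + k * a * c,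
   m * b ^+ 2 + n * d ^+ 2 + k * b * d,
   2 * m * a * b + 2 * n * c * d + k * (a * d + b * c)).

Definition vec2 (x y : int) : 'cV[int]_2 :=
  \col_i (if i == ord0 then x else y).

Lemma form_eval_vec2 (m n k x y : int) :
  form_eval (m, n, k) (vec2 x y) = m * x ^+ 2 + n * y ^+ 2 + k * x * y.
Proof. by rewrite /form_eval !mxE. Qed.

(** A form is determined by its values at (1,0), (0,1) and (1,1), so the
    substitution by a matrix can be computed on coefficients. *)
Lemma is_transformP (L : 'M[int]_2) f g :
  is_transform L f g <->
  g = subst_form (L ord0 ord0) (L ord0 ord_max) (L ord_max ord0) (L ord_max ord_max) f.
Proof.
have ev h v : form_eval h (L *m v) =
    form_eval (subst_form (L ord0 ord0) (L ord0 ord_max) (L ord_max ord0)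
                 (L ord_max ord_max) h) v.
  case: h => -[m n] k; rewrite /form_eval /= !mxE !big_ord_recl !big_ord0 /=.
  rewrite (_ : lift ord0 ord0 = ord_max); last exact: val_inj.
  ring.
rewrite /is_transform; split=> [H | -> v]; last by rewrite ev.
set s := subst_form _ _ _ _ _ in ev *.
have {}H v : form_eval g v = form_eval s v by rewrite H ev.
case: g s H {ev} => -[m n] k [[m' n'] k'] H.
have := H (vec2 1 0); have := H (vec2 0 1); have := H (vec2 1 1).
rewrite !form_eval_vec2 => e11 e01 e10.
by congr (_, _, _); lia.
Qed.

Lemma det_2x2 (L : 'M[int]_2) :
  \det L = L ord0 ord0 * L ord_max ord_max - L ord0 ord_max * L ord_max ord0.
Proof.
rewrite (expand_det_row _ ord0) !big_ord_recl big_ord0 /cofactor !det_mx11 !mxE.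
have -> : lift ord0 ord0 = ord_max :> 'I_2 by exact: val_inj.
have -> : lift ord_max 0 = ord0 :> 'I_2 by exact: val_inj.
rewrite /=; ring.
Qed.

Lemma orbit_ofP f g :
  orbit_of f g <-> exists a b c d, a * d - b * c = 1 /\ g = subst_form a b c d f.
Proof.
split=> [[L dL /is_transformP ->]|[a [b [c [d [e ->]]]]]].
  do 4 eexists; split; last reflexivity.
  by rewrite -dL det_2x2.
pose L : 'M[int]_2 := \matrix_(i, j)
  if i == ord0 then (if j == ord0 then a else b)
  else (if j == ord0 then c else d).
exists L; first by rewrite det_2x2 !mxE /=.
by apply/is_transformP; rewrite !mxE.
Qed.

Lemma subst_comp a b c d a' b' c' d' f :
  subst_form a' b' c' d' (subst_form a b c d f) =
  subst_form (a * a' + b * c') (a * b' + b * d') (c * a' + d * c') (c * b' + d * d') f.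
Proof. by case: f => -[m n] k; congr (_, _, _); ring. Qed.

Lemma subst1 f : subst_form 1 0 0 1 f = f.
Proof. by case: f => -[m n] k; congr (_, _, _); ring. Qed.

Lemma subst_inv a b c d f : a * d - b * c = 1 ->
  subst_form d (- b) (- c) a (subst_form a b c d f) = f.
Proof.
move=> e; rewrite subst_comp -[RHS]subst1.
by congr (subst_form _ _ _ _ f); lia.
Qed.

Lemma substN a b c d f : subst_form (- a) (- b) (- c) (- d) f = subst_form a b c d f.
Proof. by case: f => -[m n] k; congr (_, _, _); ring. Qed.

Lemma opAE f : opA f = subst_form 1 1 0 1 f.
Proof. by case: f => -[m n] k; congr (_, _, _); ring. Qed.

Lemma opBE f : opB f = subst_form 1 0 1 1 f.
Proof. by case: f => -[m n] k; congr (_, _, _); ring. Qed.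

Lemma disc_subst a b c d f : a * d - b * c = 1 ->
  disc (subst_form a b c d f) = disc f.
Proof.
case: f => -[m n] k e; rewrite /disc /subst_form.
by transitivity ((a * d - b * c) ^+ 2 * (k ^+ 2 - 4 * m * n));
  [ring | rewrite e; ring].
Qed.

Lemma orbit_of_trans f g h : orbit_of f g -> orbit_of f h -> orbit_of g h.
Proof.
move=> /orbit_ofP[a [b [c [d [e ->]]]]] /orbit_ofP[a' [b' [c' [d' [e' ->]]]]].
apply/orbit_ofP.
exists (d * a' - b * c'), (d * b' - b * d'), (a * c' - c * a'), (a * d' - c * b').
split; last first.
  rewrite -[in LHS](subst_inv a b c d f e) subst_comp.
  by congr (subst_form _ _ _ _ _); ring.
by transitivity ((a * d - b * c) * (a' * d' - b' * c')); [ring | rewrite e e'].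
Qed.

(** * Forms of the orbit in H^0 lie on one trajectory *)

Definition straddles (f : good_point) : Prop := 0 < f.1.1 /\ f.1.2 < 0.

(** If f(1,1) = 0 then f is isotropic over the rationals, and its discriminant
    is the square of m - n. *)
Lemma mediant_neq0 (m n k : int) :
  (~ exists s : int, disc (m, n, k) = s ^+ 2) -> m + n + k != 0.
Proof.
move=> nsq; apply/eqP => e; apply: nsq; exists (m - n).
by rewrite /disc (_ : k = - (m + n)); [ring | lia].
Qed.

(** This is the Euclidean algorithm on the rows: a nonnegative matrix of
    determinant one other than the identity has one row dominating the other,
    so the matrix of A or of B can be split off on the left. *)
Lemma nonneg_det1_cases (a b c d : int) :
  0 <= a -> 0 <= b -> 0 <= c -> 0 <= d -> a * d - b * c = 1 ->
  [\/ [/\ a = 1, b = 0, c = 0 & d = 1], c <= a /\ d <= b | a <= c /\ b <= d].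
Proof.
move=> a0 b0 c0 d0 e.
have [ca|ac] := lerP c a; have [db|bd] := lerP d b.
- by constructor 2.
- have [->|ne] := eqVneq a c; first by constructor 3; lia.
  have : d * (a - c) + c * (d - b) = 1 by lia.
  have : 0 < d * (a - c) by apply: mulr_gt0; lia.
  have : 0 <= c * (d - b) by apply: mulr_ge0; lia.
  move=> h1 h2 h3; have h4 : d * (a - c) = 1 by lia.
  have h5 : c * (d - b) = 0 by lia.
  have hc : c = 0 by nia.
  have hd : d = 1 by nia.
  by constructor 1; split; nia.
- exfalso; have : 0 <= d * (c - a) by apply: mulr_ge0; lia.
  have : 0 <= c * (b - d) by apply: mulr_ge0; lia.
  by nia.
- by constructor 3; lia.
Qed.

(** A trajectory in H^0 cannot be left by a nonnegative substitution.  Let L be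
    such a matrix, say with dominating first row.  Both columns of L are then
    in the cone spanned by (1,0) and (1,1), where f is positive as soon as
    f(1,1) > 0; since f is negative at the second column, f(1,1) < 0, so that
    A f is in H^0 and the induction proceeds with a smaller matrix. *)
Lemma subst_mem (Z : set good_point) (Delta : int) :
  (~ exists s : int, Delta = s ^+ 2) ->
  (forall f, Z f -> straddles f /\ disc f = Delta) ->
  (forall f, Z f -> straddles (opA f) -> Z (opA f)) ->
  (forall f, Z f -> straddles (opB f) -> Z (opB f)) ->
  forall (a b c d : int) f, 0 <= a -> 0 <= b -> 0 <= c -> 0 <= d -> a * d - b * c = 1 ->
  Z f -> straddles (subst_form a b c d f) -> Z (subst_form a b c d f).
Proof.
move=> nsq Zst ZA ZB a b c d f a0 b0 c0 d0.
have [N leN] : exists N : nat, a + b + c + d <= N%:Z.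
  by exists `|(a + b + c + d)%R|%N; lia.
elim: N a b c d f a0 b0 c0 d0 leN => [|N IH] a b c d f a0 b0 c0 d0 leN e Zf sf.
  by exfalso; nia.
have [[m0 n0] df] := Zst f Zf.
have mk0 : f.1.1 + f.1.2 + f.2 != 0.
  by case: f df {Zf sf m0 n0} => -[m n] k df; apply: mediant_neq0; rewrite df.
have [[ea eb ec ed]|[ca db]|[ac bd]] := nonneg_det1_cases a b c d a0 b0 c0 d0 e.
- by rewrite ea eb ec ed subst1.
- have ef : subst_form a b c d f = subst_form (a - c) (b - d) c d (opA f).
    by rewrite opAE subst_comp; congr (subst_form _ _ _ _ _); ring.
  have sA : straddles (opA f).
    case: f m0 n0 mk0 sf {df Zf ef} => -[m n] k /= m0 n0 mk0 [_ /= nd].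
    split=> //=; rewrite ltNge; apply/negP => ge0.
    suff : 0 <= m * b ^+ 2 + n * d ^+ 2 + k * b * d by lia.
    (* f(b,d), where (b,d) = (b - d)(1,0) + d(1,1) *)
    have -> : m * b ^+ 2 + n * d ^+ 2 + k * b * d =
      m * (b - d) ^+ 2 + (m + n + k) * d ^+ 2 + (2 * m + k) * ((b - d) * d).
      by ring.
    by rewrite !addr_ge0 ?mulr_ge0 ?sqr_ge0 //; lia.
  rewrite ef in sf *; apply: IH => //; try lia; last exact: ZA.
  have : c + d != 0.
    by apply/eqP => cd0; have [c00 d00] : c = 0 /\ d = 0 by [lia];
      rewrite c00 d00 in e; lia.
  by lia.
- have ef : subst_form a b c d f = subst_form a b (c - a) (d - b) (opB f).
    by rewrite opBE subst_comp; congr (subst_form _ _ _ _ _); ring.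
  have sB : straddles (opB f).
    case: f m0 n0 mk0 sf {df Zf ef} => -[m n] k /= m0 n0 mk0 [/= md _].
    split=> //=; rewrite ltNge; apply/negP => ge0.
    suff : 0 <= - (m * a ^+ 2 + n * c ^+ 2 + k * a * c) by lia.
    (* - f(a,c), where (a,c) = (c - a)(0,1) + a(1,1) *)
    have -> : - (m * a ^+ 2 + n * c ^+ 2 + k * a * c) =
      (- n) * (c - a) ^+ 2 + (- (m + n + k)) * a ^+ 2 +
      (- (2 * n + k)) * ((c - a) * a) by ring.
    by rewrite !addr_ge0 ?mulr_ge0 ?sqr_ge0 //; lia.
  rewrite ef in sf *; apply: IH => //; try lia; last exact: ZB.
  have : a + b != 0.
    by apply/eqP => ab0; have [a00 b00] : a = 0 /\ b = 0 by [lia];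
      rewrite a00 b00 in e; lia.
  by lia.
Qed.

(** In the first quadrant a form of H^0 is positive first and negative later in
    the direction of rotation, so a positive vector (a,c) cannot come after a
    negative one (b,d), which is what b c - a d > 0 says. *)
Lemma straddling_order (m n k a b c d : int) : 0 < m -> n < 0 ->
  0 <= a -> 0 <= b -> 0 <= c -> 0 <= d -> b * c - a * d = 1 ->
  0 < m * a ^+ 2 + n * c ^+ 2 + k * a * c ->
  m * b ^+ 2 + n * d ^+ 2 + k * b * d < 0 -> False.
Proof.
move=> m0 n0 a0 b0 c0 d0 e.
set p := (X in 0 < X -> _); set q := (X in _ -> X < 0 -> _) => p0 q0.
(* Eliminating k between the values p at (a,c) and q at (b,d) leaves a
   combination whose four terms are nonnegative, hence all zero. *)
have id : p * (b * d) + (- q) * (a * c) + m * (a * b) + (- n) * (c * d) = 0.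
  by transitivity ((m * (a * b) - n * (c * d)) * (1 - (b * c - a * d)));
    [rewrite /p /q; ring | rewrite e; ring].
have h1 : 0 <= p * (b * d) by rewrite !mulr_ge0 // ltW.
have h2 : 0 <= (- q) * (a * c) by rewrite !mulr_ge0 // oppr_ge0 ltW.
have h3 : 0 <= m * (a * b) by rewrite !mulr_ge0 // ltW.
have h4 : 0 <= (- n) * (c * d) by rewrite !mulr_ge0 // oppr_ge0 ltW.
have ab : a * b = 0.
  have /eqP : m * (a * b) = 0.
    move: id h1 h2 h3 h4.
    move: (p * (b * d)) (- q * (a * c)) (m * (a * b)) (- n * (c * d)).
    by clear => u v w z; lia.
  by rewrite mulf_eq0 gt_eqF //= => /eqP.
have c1 : 0 < c by rewrite lt_neqAle c0 andbT; apply/eqP => e0; nia.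
have b1 : 0 < b by rewrite lt_neqAle b0 andbT; apply/eqP => e0; nia.
have ea : a = 0 by nia.
by move: p0; rewrite /p ea; have : 0 < c ^+ 2 by [rewrite exprn_gt0]; nia.
Qed.

Ltac pattern_lia :=
  solve [constructor 1; split; lia | constructor 2; split; lia
        | constructor 3; split; lia | constructor 4; split; lia].

(** Up to a global sign there are four sign patterns: L nonnegative, the inverse
    of L nonnegative, and two patterns whose columns are in the same quadrant but
    in the wrong order.  If b c >= 0 then a d = 1 + b c >= 0, which gives the
    first two; otherwise a d <= 0, which gives the others. *)
Lemma det1_signs (a b c d : int) : a * d - b * c = 1 ->
  exists2 s : int, s = 1 \/ s = - 1 &
  [\/ [/\ 0 <= s * a, 0 <= s * b, 0 <= s * c & 0 <= s * d],
      [/\ 0 <= s * a, s * b <= 0, s * c <= 0 & 0 <= s * d],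
      [/\ 0 <= s * a, s * b <= 0, 0 <= s * c & s * d <= 0] |
      [/\ 0 <= s * a, 0 <= s * b, s * c <= 0 & s * d <= 0]].
Proof.
move=> e.
have same_sign (x y : int) : 0 <= x * y -> (0 <= x /\ 0 <= y) \/ (x <= 0 /\ y <= 0).
  have [x0|x0|->] := ltgtP x 0; last by lia.
  - by rewrite nmulr_rge0 //; lia.
  - by rewrite pmulr_rge0 //; lia.
have [q0|q0] := lerP 0 (b * c).
- have p0 : 0 <= a * d by lia.
  have [sbc|sbc] := same_sign _ _ q0; have [sad|sad] := same_sign _ _ p0;
    solve [exists 1; [by left | pattern_lia] | exists (- 1); [by right | pattern_lia]].
- have p0 : 0 <= a * (- d) by lia.
  have {}q0 : 0 <= b * (- c) by lia.
  have [sbc|sbc] := same_sign _ _ q0; have [sad|sad] := same_sign _ _ p0;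
    solve [exists 1; [by left | pattern_lia] | exists (- 1); [by right | pattern_lia]].
Qed.

(** When the inverse of L is nonnegative, [subst_mem] is applied backwards, to
    the complement of Z; this is where closure of Z under predecessors is used. *)
Lemma straddling_orbit_mem (Z : set good_point) (Delta : int) :
  (~ exists s : int, Delta = s ^+ 2) ->
  (forall f, Z f -> straddles f /\ disc f = Delta) ->
  (forall f, Z f -> straddles (opA f) -> Z (opA f)) ->
  (forall f, Z f -> straddles (opB f) -> Z (opB f)) ->
  (forall f, straddles f -> disc f = Delta -> Z (opA f) -> Z f) ->
  (forall f, straddles f -> disc f = Delta -> Z (opB f) -> Z f) ->
  forall f g, Z f -> orbit_of f g -> straddles g -> Z g.
Proof.
move=> nsq Zst ZA ZB ZA' ZB' f g Zf /orbit_ofP[a0 [b0 [c0 [d0 [e0 ->]]]]].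
have [s s1] := det1_signs a0 b0 c0 d0 e0.
have -> : subst_form a0 b0 c0 d0 f = subst_form (s * a0) (s * b0) (s * c0) (s * d0) f.
  by case: s1 => ->; rewrite ?mul1r // !mulN1r substN.
have : (s * a0) * (s * d0) - (s * b0) * (s * c0) = 1.
  by transitivity (s * s * (a0 * d0 - b0 * c0)); [ring | rewrite e0; case: s1 => ->].
move: (s * a0) (s * b0) (s * c0) (s * d0) => {e0 s1} a b c d e signs sg.
have [[m0 n0] df] := Zst f Zf.
case: signs => -[ha hb hc hd].
- exact: (subst_mem Z Delta).
- apply: contrapT => nZg.
  pose N : set good_point := [set h | [/\ straddles h, disc h = Delta & ~ Z h]].
  suff : N (subst_form d (- b) (- c) a (subst_form a b c d f)) by rewrite subst_inv // => -[].
  apply: (subst_mem N Delta) => //; rewrite ?subst_inv //; try lia.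
  + by move=> h [].
  + by move=> h [sh dh nZh] sAh; split=> //;
      [rewrite opAE disc_subst | move=> Zh; apply: nZh; apply: ZA'].
  + by move=> h [sh dh nZh] sBh; split=> //;
      [rewrite opBE disc_subst | move=> Zh; apply: nZh; apply: ZB'].
  + by split=> //; rewrite disc_subst.
- exfalso; case: f m0 n0 sg {Zf df} => -[m n] k /= m0 n0 [/= fa fb].
  apply: (straddling_order m n k a (- b) c (- d)) => //; try lia.
- exfalso; case: f m0 n0 sg {Zf df} => -[m n] k /= m0 n0 [/= fa fb].
  apply: (straddling_order m n (- k) a b (- c) (- d)) => //; try lia.
Qed.

(** * The monoid generated by A and B is free *)

Lemma opA_inj : injective opA.
Proof. by move=> [[m n] k] [[m' n'] k'] [*]; congr (_, _, _); lia. Qed.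

Lemma opB_inj : injective opB.
Proof. by move=> [[m n] k] [[m' n'] k'] [*]; congr (_, _, _); lia. Qed.

Lemma letter_op_inj l : injective (letter_op l).
Proof. by case: l; [exact: opA_inj | exact: opB_inj]. Qed.

Lemma word_op_rcons w l f : word_op (rcons w l) f = letter_op l (word_op w f).
Proof. by rewrite /word_op foldl_rcons. Qed.

(** On the positive definite form x^2 + y^2, applying A makes n larger than m
    and applying B makes m larger than n, so the last letter of a word can be
    read off from the result. *)
Lemma word_op_positive w :
  [/\ 0 < (word_op w (1, 1, 0)).1.1, 0 < (word_op w (1, 1, 0)).1.2
    & 0 <= (word_op w (1, 1, 0)).2].
Proof.
elim/last_ind: w => [//|w l]; rewrite word_op_rcons.
by case: l (word_op w _) => -[[m n] k] /= [*]; split; lia.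
Qed.

Lemma word_op_inj (w v : seq letter) : word_op w =1 word_op v -> w = v.
Proof.
move=> /(_ (1, 1, 0)).
elim/last_ind: w v => [|w l IH] v; case/lastP: v => [//|v l'];
  rewrite ?word_op_rcons.
- case: l' (word_op v _) (word_op_positive v) => -[[m n] k] /= [? ? ?] [*]; lia.
- case: l (word_op w _) (word_op_positive w) => -[[m n] k] /= [? ? ?] [*]; lia.
- move=> e; have el : l = l'.
    case: l l' (word_op w _) (word_op v _) (word_op_positive w) (word_op_positive v) e
      => -[] // [[m n] k] [[m' n'] k'] /= [? ? ?] [? ? ?] [*]; lia.
  by rewrite -el in e *; rewrite (IH v) //; apply: letter_op_inj e.
Qed.

(** * The regions in terms of the coefficients m, n, k *)

Section FormCoordinates.
Variable R : realType.
Variable Delta : int.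
Implicit Types m n k : R.

Definition form_pt m n k : R * R * R := (k, m - n, m + n).

Definition coef_m (P : R * R * R) : R := (coordS P + coordD P) / 2.
Definition coef_n (P : R * R * R) : R := (coordS P - coordD P) / 2.

Lemma form_ptE P : form_pt (coef_m P) (coef_n P) (coordK P) = P.
Proof.
case: P => -[K D] S; rewrite /form_pt /coef_m /coef_n /coordS /coordD /coordK /=.
by congr (_, _, _); field.
Qed.

Lemma coef_m_pt m n k : coef_m (form_pt m n k) = m.
Proof. by rewrite /coef_m /coordS /coordD /=; field. Qed.

Lemma coef_n_pt m n k : coef_n (form_pt m n k) = n.
Proof. by rewrite /coef_n /coordS /coordD /=; field. Qed.

Lemma coordK_pt m n k : coordK (form_pt m n k) = k.
Proof. by []. Qed.

Definition coefE := (coef_m_pt, coef_n_pt, coordK_pt).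

Lemma form_ptP (Q : R * R * R -> Prop) : (forall m n k, Q (form_pt m n k)) -> forall P, Q P.
Proof. by move=> H P; rewrite -(form_ptE P). Qed.

Lemma embedE (f : good_point) :
  embed R f = form_pt f.1.1%:~R f.1.2%:~R f.2%:~R.
Proof. by case: f => -[m n] k; rewrite /embed /form_pt !rmorphB !rmorphD. Qed.

Lemma hyperboloid_pt m n k :
  hyperboloid Delta (form_pt m n k) <-> k ^+ 2 - 4 * m * n = Delta%:~R.
Proof.
rewrite /hyperboloid /coordK /coordD /coordS /=.
by rewrite (_ : k ^+ 2 + (m - n) ^+ 2 - (m + n) ^+ 2 = k ^+ 2 - 4 * m * n); last ring.
Qed.

Lemma normB_lt_add m n : `|m - n| < m + n <-> 0 < m /\ 0 < n.
Proof.
by rewrite ltr_norml; split=> [/andP[*]|[*]]; [split|apply/andP; split]; lra.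
Qed.

Lemma H0_pt m n k :
  H0 Delta (form_pt m n k) <-> hyperboloid Delta (form_pt m n k) /\ 0 < m /\ n < 0.
Proof.
rewrite /H0 /setI /= /coordD /coordS /=; split=> -[hP].
  move=> [+ D0]; rewrite (gtr0_norm D0) ltr_norml => /andP[*].
  by split=> //; split; lra.
move=> [m0 n0]; split=> //; have D0 : 0 < m - n by lra.
by rewrite (gtr0_norm D0) ltr_norml; split=> //; apply/andP; split; lra.
Qed.

Lemma G_A_pt m n k :
  G_A R Delta (form_pt m n k) <->
  hyperboloid Delta (form_pt m n k) /\ [/\ 0 < m, 0 < n & 0 < k].
Proof.
rewrite /G_A /setI /= /coordD /coordS /coordK /= normB_lt_add.
by split=> [[? [[? ?] ?]]|[? [? ? ?]]].
Qed.

Lemma H_A_pt m n k :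
  H_A R Delta (form_pt m n k) <->
  hyperboloid Delta (form_pt m n k) /\ [/\ 0 < m, 0 < n & m + n < k].
Proof.
rewrite /H_A /H_outer /setI /= /coordD /coordS /coordK /=; split.
  move=> [[hP [DS SK]] [S0 K0]]; rewrite (gtr0_norm S0) in DS SK.
  by rewrite (gtr0_norm K0) in SK; have [? ?] := (normB_lt_add m n).1 DS.
move=> [hP [m0 n0 mnk]].
rewrite (gtr0_norm (_ : 0 < m + n)) ?(gtr0_norm (_ : 0 < k)); [|lra..].
by do ![split] => //; [exact/normB_lt_add|lra..].
Qed.

(** The inequality bounds the absolute value of S, hence is two inequalities:
    they are the signs of the form at (q,p) and at (-p,q). *)
Lemma rhombus_pt (p q : int) m n k :
  rhombus Delta p q (form_pt m n k) <->
  [/\ hyperboloid Delta (form_pt m n k),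
      0 < m * q%:~R ^+ 2 + n * p%:~R ^+ 2 + k * p%:~R * q%:~R
    & m * p%:~R ^+ 2 + n * q%:~R ^+ 2 - k * p%:~R * q%:~R < 0].
Proof.
rewrite /rhombus /setI /= /coordD /coordS /coordK /=.
rewrite !(rmorphD, rmorphN, rmorphM, rmorphXn, rmorph_nat) /=.
move: (p%:~R : R) (q%:~R : R) => x y.
have h0 : 0 <= x ^+ 2 + y ^+ 2 by rewrite addr_ge0 ?sqr_ge0.
have -> : (x ^+ 2 + y ^+ 2) * `|m + n| = `|(x ^+ 2 + y ^+ 2) * (m + n)|.
  by rewrite normrM (ger0_norm h0).
rewrite ltr_norml.
split=> [[hP /andP[h1 h2]]|[hP h1 h2]]; split=> //; last (apply/andP; split).
all: lra.
Qed.

End FormCoordinates.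

Arguments form_pt {R}.
Arguments coef_m {R}.
Arguments coef_n {R}.

(** * Cells: the images of H_A under words in A and B *)

Lemma pos_generation_gt0 n x : pos_generation n x -> (0 < n)%N /\ 0 < x.
Proof.
elim=> [//|{}n {}x _ [_ x0]|{}n {}x _ [_ x0]]; split=> //.
  by rewrite addr_gt0.
by rewrite divr_gt0 // addr_gt0.
Qed.

Lemma pos_generationI n x : pos_generation n x -> pos_generation n x^-1.
Proof.
elim=> [|{}n {}x gx IH|{}n {}x gx IH]; first by rewrite invr1; constructor.
  have [_ x0] := pos_generation_gt0 _ _ gx.
  have -> : (x + 1)^-1 = x^-1 / (x^-1 + 1).
    by field; rewrite !gt_eqF // addr_gt0.
  exact: pos_generationV.
have [_ x0] := pos_generation_gt0 _ _ gx.
have -> : (x / (x + 1))^-1 = x^-1 + 1.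
  by field; rewrite !gt_eqF // addr_gt0.
exact: pos_generationD.
Qed.

Section Cells.
Variable R : realType.
Variable Delta : int.

Local Notation R3 := (R * R * R)%type.
Local Notation GA := (G_A R Delta).
Implicit Types P : R3.

Definition letter_opR (l : letter) P : R3 :=
  if l is LA then form_pt (coef_m P) (coef_m P + coef_n P + coordK P) (coordK P + 2 * coef_m P)
  else form_pt (coef_m P + coef_n P + coordK P) (coef_n P) (coordK P + 2 * coef_n P).

Definition letter_opRi (l : letter) P : R3 :=
  if l is LA then form_pt (coef_m P) (coef_m P + coef_n P - coordK P) (coordK P - 2 * coef_m P)
  else form_pt (coef_m P + coef_n P - coordK P) (coef_n P) (coordK P - 2 * coef_n P).

Lemma embed_letter_op l f : embed R (letter_op l f) = letter_opR l (embed R f).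
Proof.
rewrite !embedE /letter_opR !coefE; case: l; case: f => -[m n] k /=.
  by rewrite !(rmorphD, rmorphM, rmorph_nat).
by rewrite !(rmorphD, rmorphM, rmorph_nat).
Qed.

Lemma letter_opRK l : cancel (letter_opR l) (letter_opRi l).
Proof.
elim/form_ptP => m n k; rewrite /letter_opR /letter_opRi; case: l; rewrite !coefE;
  by congr (form_pt _ _ _); ring.
Qed.

Lemma letter_opRiK l : cancel (letter_opRi l) (letter_opR l).
Proof.
elim/form_ptP => m n k; rewrite /letter_opR /letter_opRi; case: l; rewrite !coefE;
  by congr (form_pt _ _ _); ring.
Qed.

Lemma hyperboloid_letter_opR l P : hyperboloid Delta (letter_opR l P) <-> hyperboloid Delta P.
Proof.
elim/form_ptP: P => m n k; rewrite /letter_opR; case: l; rewrite !coefE !hyperboloid_pt.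
  by rewrite (_ : (k + 2 * m) ^+ 2 - 4 * m * (m + n + k) = k ^+ 2 - 4 * m * n); last ring.
by rewrite (_ : (k + 2 * n) ^+ 2 - 4 * (m + n + k) * n = k ^+ 2 - 4 * m * n); last ring.
Qed.

Lemma G_A_letter_opR l P : GA P -> GA (letter_opR l P).
Proof.
move=> GP; have [hP _] := GP; move/hyperboloid_letter_opR: hP => /(_ l).
elim/form_ptP: P GP => m n k /G_A_pt[_ [m0 n0 k0]].
by case: l; rewrite /letter_opR !coefE => hP; apply/G_A_pt; split=> //; split; lra.
Qed.

(** The head letter is the one that acts last, so that splitting it off undoes
    the outermost operator. *)
Fixpoint cell (w : seq letter) P : Prop :=
  if w is l :: w' then cell w' (letter_opRi l P) else H_A R Delta P.

Lemma cell_cons l w P : cell (l :: w) (letter_opR l P) <-> cell w P.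
Proof. by rewrite /= letter_opRK. Qed.

Lemma letter_imageP l (Q : R3 -> Prop) : (forall P, Q (letter_opR l P)) -> forall P, Q P.
Proof. by move=> H P; rewrite -(letter_opRiK l P). Qed.

Lemma H_A_sub_G_A P : H_A R Delta P -> GA P.
Proof.
elim/form_ptP: P => m n k /H_A_pt[hP [*]]; apply/G_A_pt; split=> //; split; lra.
Qed.

Lemma cell_sub_G_A w P : cell w P -> GA P.
Proof.
elim: w P => [|l w IH]; first exact: H_A_sub_G_A.
by elim/(letter_imageP l) => P /cell_cons/IH; exact: G_A_letter_opR.
Qed.

(** The value of the form at (-x,1); for x > 0 this is a direction in the second
    quadrant. *)
Definition eval_neg P (x : R) : R := coef_m P * x ^+ 2 - coordK P * x + coef_n P.

Lemma eval_neg_opA P x : eval_neg (letter_opR LA P) (x + 1) = eval_neg P x.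
Proof. by rewrite /eval_neg /letter_opR !coefE; ring. Qed.

Lemma eval_neg_opB P x : x + 1 != 0 ->
  (x + 1) ^+ 2 * eval_neg (letter_opR LB P) (x / (x + 1)) = eval_neg P x.
Proof. by move=> x0; rewrite /eval_neg /letter_opR !coefE; field. Qed.

(** A form A f is f(x+y,y), and (-x,1) is sent to (1-x,1), which stays in the
    closed first quadrant when x <= 1; similarly for B below. *)
Lemma eval_neg_opA_gt0 P x : GA P -> 0 < x <= 1 -> 0 < eval_neg (letter_opR LA P) x.
Proof.
elim/form_ptP: P => m n k /G_A_pt[_ [m0 n0 k0]] /andP[x0 x1].
rewrite /eval_neg /letter_opR !coefE.
have -> : m * x ^+ 2 - (k + 2 * m) * x + (m + n + k) =
  n + (m * (1 - x) ^+ 2 + k * (1 - x)) by ring.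
by rewrite ltr_wpDr // addr_ge0 // mulr_ge0 ?sqr_ge0 ?subr_ge0 // ltW.
Qed.

Lemma eval_neg_opB_gt0 P x : GA P -> 1 <= x -> 0 < eval_neg (letter_opR LB P) x.
Proof.
elim/form_ptP: P => m n k /G_A_pt[_ [m0 n0 k0]] x1.
rewrite /eval_neg /letter_opR !coefE.
have -> : (m + n + k) * x ^+ 2 - (k + 2 * n) * x + n =
  m * x ^+ 2 + (n * (x - 1) ^+ 2 + k * x * (x - 1)) by ring.
rewrite ltr_wpDr //; last by rewrite mulr_gt0 // exprn_gt0 //; lra.
by rewrite addr_ge0 // ?mulr_ge0 ?sqr_ge0 ?subr_ge0 //; lra.
Qed.

Lemma ratr_div_succ (x : rat) :
  ratr (x / (x + 1)) = ratr x / (ratr x + 1) :> R.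
Proof. by rewrite fmorph_div rmorphD rmorph1. Qed.

Lemma ratr_gen_gt0 n x : pos_generation n x -> 0 < ratr x :> R.
Proof. by move=> /pos_generation_gt0[_ x0]; rewrite ltr0q. Qed.

(** The direction (-1,1), negative on H_A, is transported along the word. *)
Lemma cell_gen w P : cell w P ->
  exists2 x, pos_generation (size w).+1 x & eval_neg P (ratr x) < 0.
Proof.
elim: w P => [|l w IH].
  elim/form_ptP => m n k /H_A_pt[_ [m0 n0 k0]]; exists 1; first by constructor.
  by rewrite /eval_neg !coefE rmorph1; lra.
elim/(letter_imageP l) => P /cell_cons/IH[x gx qx].
have x0 := ratr_gen_gt0 _ _ gx.
case: l; [exists (x + 1) | exists (x / (x + 1))]; try by constructor.
  by rewrite rmorphD rmorph1 eval_neg_opA.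
rewrite ratr_div_succ.
have x1 : 0 < ratr x + 1 :> R by lra.
by rewrite -(@pmulr_rlt0 _ ((ratr x + 1) ^+ 2)) ?exprn_gt0 // eval_neg_opB ?(gt_eqF x1).
Qed.

(** A direction of generation at most the length of w leaves the second quadrant
    while the letters of w are undone: either it takes the wrong branch at some
    letter, or it reaches the boundary.  The form is then positive there. *)
Lemma cell_eval_neg_gt0 w P j x : cell w P -> pos_generation j x ->
  (j <= size w)%N -> 0 < eval_neg P (ratr x).
Proof.
elim: w P j x => [|l w IH] P j x.
  by move=> _ /pos_generation_gt0[j0 _] /=; rewrite leqNgt j0.
elim/(letter_imageP l): P => P /cell_cons cP gx; have GP := cell_sub_G_A _ _ cP.
case: gx => [|{}j {}x gx|{}j {}x gx] /= lej.
- rewrite rmorph1; case: l; first by rewrite eval_neg_opA_gt0 // ltr01 lexx.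
  exact: eval_neg_opB_gt0.
- have x0 := ratr_gen_gt0 _ _ gx; rewrite rmorphD rmorph1.
  case: l; first by rewrite eval_neg_opA; exact: IH cP gx _.
  by apply: eval_neg_opB_gt0 => //; lra.
- have x0 := ratr_gen_gt0 _ _ gx; rewrite ratr_div_succ.
  case: l.
    apply: eval_neg_opA_gt0 => //; rewrite divr_gt0 ?addr_gt0 //=.
    by rewrite ler_pdivrMr ?addr_gt0 //; lra.
  have x1 : 0 < ratr x + 1 :> R by lra.
  rewrite -(@pmulr_rgt0 _ ((ratr x + 1) ^+ 2)) ?exprn_gt0 //.
  by rewrite eval_neg_opB ?(gt_eqF x1) //; exact: (IH _ _ _ cP gx lej).
Qed.

(** Conversely the word is read off from the construction of x.  Positivity in
    generation one, that is m + n - k > 0, ensures that undoing the letter stays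
    in G_A. *)
Lemma cell_exists r x P : pos_generation r x -> GA P -> eval_neg P (ratr x) < 0 ->
  (forall j y, pos_generation j y -> (j < r)%N -> 0 < eval_neg P (ratr y)) ->
  exists2 w, size w = r.-1 & cell w P.
Proof.
move=> gx; elim: gx P => [|{}r {}x gx IH|{}r {}x gx IH] P GP qP old.
- exists [::] => //=; elim/form_ptP: P GP qP {old} => m n k /G_A_pt[hP [m0 n0 k0]].
  by rewrite /eval_neg !coefE rmorph1 => q; apply/H_A_pt; split=> //; split; lra.
- have [r0 _] := pos_generation_gt0 _ _ gx; have x0 := ratr_gen_gt0 _ _ gx.
  have q1 := old 1%N 1 pos_generation1 r0.
  elim/(letter_imageP LA): P GP qP q1 old => P GP; rewrite rmorphD rmorph1 eval_neg_opA => qP q1 old.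
  have {}GP : GA P.
    have [/hyperboloid_letter_opR hP _] := GP.
    elim/form_ptP: P GP hP qP q1 {old} => m n k;
      rewrite /eval_neg /letter_opR !coefE => /G_A_pt[_ [h1 h2 h3]] hP qP q1.
    have n0 : 0 < n by lra.
    apply/G_A_pt; split=> //; split=> //.
    (* k x > m x^2 + n > 0 *)
    rewrite -(pmulr_lgt0 _ x0); have : 0 < m * (ratr x) ^+ 2 by rewrite mulr_gt0 // exprn_gt0.
    lra.
  have [j y gy lt|w sw cw] := IH P GP qP.
    by have := old _ _ (pos_generationD gy) lt; rewrite rmorphD rmorph1 eval_neg_opA.
  by exists (LA :: w); [rewrite /= sw prednK | apply/cell_cons].
- have [r0 _] := pos_generation_gt0 _ _ gx; have x0 := ratr_gen_gt0 _ _ gx.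
  have q1 := old 1%N 1 pos_generation1 r0.
  elim/(letter_imageP LB): P GP qP q1 old => P GP qP q1 old.
  have {}qP : eval_neg P (ratr x) < 0.
    rewrite ratr_div_succ in qP.
    have x1 : 0 < ratr x + 1 :> R by lra.
    by rewrite -eval_neg_opB ?(gt_eqF x1) // pmulr_rlt0 ?exprn_gt0.
  have {}GP : GA P.
    have [/hyperboloid_letter_opR hP _] := GP.
    elim/form_ptP: P GP hP qP q1 {old} => m n k;
      rewrite /eval_neg /letter_opR !coefE rmorph1 => /G_A_pt[_ [h1 h2 h3]] hP qP q1.
    have m0 : 0 < m by lra.
    apply/G_A_pt; split=> //; split=> //.
    (* k x > m x^2 + n > 0 *)
    rewrite -(pmulr_lgt0 _ x0); have : 0 < m * (ratr x) ^+ 2 by rewrite mulr_gt0 // exprn_gt0.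
    lra.
  have [j y gy lt|w sw cw] := IH P GP qP.
    have y1 : 0 < ratr y + 1 :> R by have := ratr_gen_gt0 _ _ gy; lra.
    rewrite -eval_neg_opB ?(gt_eqF y1) // pmulr_rgt0 ?exprn_gt0 // -ratr_div_succ.
    exact: (old _ _ (pos_generationV gy)).
  by exists (LB :: w); [rewrite /= sw prednK | apply/cell_cons].
Qed.

(** On G_A the image of A has m < n and that of B has n < m. *)
Lemma cell_disjoint w v P : size w = size v -> cell w P -> cell v P -> w = v.
Proof.
elim: w v P => [|l w IH] [|l' v] //= P [sz] cw cv.
have el : l = l'.
  have := cell_sub_G_A _ _ cw; have := cell_sub_G_A _ _ cv; clear cw cv sz IH.
  elim/form_ptP: P => m n k; rewrite /letter_opRi !coefE.
  by case: l'; case: l => // /G_A_pt[_ [a1 a2 a3]] /G_A_pt[_ [b1 b2 b3]]; exfalso; lra.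
by rewrite -el in cv *; rewrite (IH v _ sz cw cv).
Qed.

Lemma rhombus_G_A (x : rat) P : GA P -> 0 < x ->
  rhombus Delta (numq x) (denq x) P <-> eval_neg P (ratr x) < 0.
Proof.
elim/form_ptP: P => m n k /G_A_pt[hP [m0 n0 k0]] x0.
have p0 : 0 < (numq x)%:~R :> R by rewrite ltr0z numq_gt0.
have q0 : 0 < (denq x)%:~R :> R by rewrite ltr0z denq_gt0.
rewrite rhombus_pt /ratr /eval_neg !coefE.
move: ((numq x)%:~R : R) ((denq x)%:~R : R) p0 q0 => p q p0 q0.
have -> : m * (p / q) ^+ 2 - k * (p / q) + n =
  (m * p ^+ 2 + n * q ^+ 2 - k * p * q) / q ^+ 2 by field; rewrite gt_eqF.
rewrite pmulr_llt0 ?invr_gt0 ?exprn_gt0 //; split=> [[]|h] //; split=> //.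
by rewrite !addr_gt0 ?mulr_gt0 ?exprn_gt0.
Qed.

(** A rhombus of generation zero or of negative slope would make the form
    nonpositive somewhere in the closed first quadrant, so only positive slopes
    occur. *)
Lemma Hgen_G_A r P : GA P ->
  Hgen Delta r P <-> exists2 x, pos_generation r x & eval_neg P (ratr x) < 0.
Proof.
move=> GP; split=> [[p [q [gpq rh]]]|[x gx qx]]; last first.
  exists (numq x), (denq x); have [r0 x0] := pos_generation_gt0 _ _ gx.
  split; last exact/rhombus_G_A.
  by case: r r0 gx => //= r _ gx; exists x; rewrite gtr0_norm.
elim/form_ptP: P GP rh => m n k GP rh.
have /G_A_pt[hP [m0 n0 k0]] := GP; have /rhombus_pt[_ _ rh2] := rh.
case: r gpq => [|r] /= gpq.
  by exfalso; case: gpq rh2 => -[-> ->]; rewrite ?mulr0z ?mulr1z; lra.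
move: gpq => [x [gx ep eq]]; rewrite ep eq in rh rh2.
have [x0|x0|x0] := ltgtP x 0.
- exfalso; move: rh2.
  have p0 : (numq x)%:~R < 0 :> R by rewrite ltrz0 numq_lt0.
  have q0 : 0 < (denq x)%:~R :> R by rewrite ltr0z denq_gt0.
  move: ((numq x)%:~R : R) ((denq x)%:~R : R) p0 q0 => u v p0 q0.
  have h1 : 0 <= m * u ^+ 2 by rewrite mulr_ge0 ?sqr_ge0 // ltW.
  have h2 : 0 < n * v ^+ 2 by rewrite mulr_gt0 ?exprn_gt0.
  have h3 : 0 < k * (- u) * v by rewrite !mulr_gt0 // oppr_gt0.
  lra.
- by exists x; [rewrite gtr0_norm in gx | exact/rhombus_G_A].
- by exfalso; have [_] := pos_generation_gt0 _ _ gx; rewrite x0 normr0 ltxx.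
Qed.

End Cells.

Arguments letter_opR {R}.
Arguments letter_opRi {R}.
Arguments eval_neg {R}.

(** * The domains of G_A are the cells *)

Lemma continuous_pair (T U V : topologicalType) (f : T -> U) (g : T -> V) (x : T) :
  {for x, continuous f} -> {for x, continuous g} ->
  {for x, continuous (fun y => (f y, g y))}.
Proof. by move=> cf cg; apply: cvg_pair. Qed.

Section Domains.
Variable R : realType.
Variable Delta : int.
Hypothesis Delta_gt0 : 0 < Delta.

Local Notation R3 := (R * R * R)%type.
Local Notation GA := (G_A R Delta).
Local Notation cell := (cell R Delta).
Implicit Types P : R3.

Lemma coordK_continuous : continuous (@coordK R).
Proof. by move=> P; apply: cvg_comp; exact: cvg_fst. Qed.

Lemma coordD_continuous : continuous (@coordD R).
Proof. by move=> P; apply: cvg_comp; [exact: cvg_fst | exact: cvg_snd]. Qed.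

Lemma coordS_continuous : continuous (@coordS R).
Proof. by move=> P; exact: cvg_snd. Qed.

Section RealValued.
Variables (T : topologicalType) (f g : T -> R).
Hypotheses (cf : continuous f) (cg : continuous g).

Lemma contD : continuous (fun x => f x + g x).
Proof. by move=> x; apply: cvgD; [exact: cf | exact: cg]. Qed.

Lemma contN : continuous (fun x => - f x).
Proof. by move=> x; apply: cvgN; exact: cf. Qed.

Lemma contM : continuous (fun x => f x * g x).
Proof. by move=> x; apply: cvgM; [exact: cf | exact: cg]. Qed.

Lemma contX n : continuous (fun x => f x ^+ n).
Proof.
move=> x; apply: (@continuous_comp _ _ _ f (fun y => y ^+ n) x); first exact: cf.
exact: exprn_continuous.
Qed.

Lemma continuous_form_pt (h : T -> R) : continuous h ->
  continuous (fun x => form_pt (f x) (g x) (h x)).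
Proof.
move=> ch x.
apply: (@continuous_pair _ _ _ (fun y => (h y, f y - g y)) (fun y => f y + g y));
  last exact: contD.
apply: (@continuous_pair _ _ _ h (fun y => f y - g y)); first exact: ch.
by apply: cvgB; [exact: cf | exact: cg].
Qed.

End RealValued.

Lemma continuous_cst (T : topologicalType) (a : R) : continuous (fun _ : T => a).
Proof. by move=> x; exact: cvg_cst. Qed.

Ltac continuity :=
  lazymatch goal with
  | |- continuous (fun x => @GRing.add _ (@?f x) (@?g x)) =>
      apply: (@contD _ f g); continuity
  | |- continuous (fun x => @GRing.opp _ (@?f x)) => apply: (@contN _ f); continuity
  | |- continuous (fun x => @GRing.mul _ (@?f x) (@?g x)) =>
      apply: (@contM _ f g); continuity
  | |- continuous (fun x => @GRing.exp _ (@?f x) _) => apply: (@contX _ f); continuity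
  | |- continuous (fun x => form_pt (@?f x) (@?g x) (@?h x)) =>
      apply: (@continuous_form_pt _ f g _ _ h); continuity
  | |- continuous (fun _ => ?a) => exact: continuous_cst
  | |- continuous (fun x => x) => move=> ?; exact: cvg_id
  | |- _ => try done
  end.

Lemma coef_m_continuous : continuous (@coef_m R).
Proof. by rewrite /coef_m; continuity; [exact: coordS_continuous | exact: coordD_continuous]. Qed.

Lemma coef_n_continuous : continuous (@coef_n R).
Proof. by rewrite /coef_n; continuity; [exact: coordS_continuous | exact: coordD_continuous]. Qed.

Hint Resolve coordK_continuous coef_m_continuous coef_n_continuous : core.

Lemma letter_opR_continuous l : continuous (@letter_opR R l).
Proof. by case: l; rewrite /letter_opR; continuity. Qed.

Lemma letter_opRi_continuous l : continuous (@letter_opRi R l).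
Proof. by case: l; rewrite /letter_opRi; continuity. Qed.

Lemma open_pos (f : R3 -> R) : continuous f -> open [set P | 0 < f P].
Proof. by move=> cf; apply: (@open_comp _ _ f [set y | 0 < y]) => //; exact: open_gt. Qed.

(** The strict inequalities that cut a cell out of the hyperboloid; unlike the
    cell itself they define an open set of the ambient space. *)
Fixpoint cell_ineq (w : seq letter) P : Prop :=
  if w is l :: w' then cell_ineq w' (letter_opRi l P)
  else [/\ 0 < coef_m P, 0 < coef_n P & 0 < coordK P - coef_m P - coef_n P].

Lemma cell_ineqP w P : cell w P <-> hyperboloid Delta P /\ cell_ineq w P.
Proof.
elim: w P => [|l w IH].
  elim/form_ptP => m n k; rewrite [cell _ _]/= H_A_pt /= !coefE.
  by split=> -[hP [*]]; split=> //; split; lra.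
elim/(letter_imageP R l) => P /=; rewrite letter_opRK IH.
by split=> -[/hyperboloid_letter_opR h c]; split=> //; exact/hyperboloid_letter_opR.
Qed.

Lemma cell_ineq_open w : open [set P | cell_ineq w P].
Proof.
elim: w => [|l w IH] /=.
  rewrite (_ : [set P | _] = [set P | 0 < coef_m P] `&` [set P | 0 < coef_n P]
     `&` [set P | 0 < coordK P - coef_m P - coef_n P]); last first.
    by apply/seteqP; split=> P /=; [case=> *; split | case=> -[]].
  by apply: openI; [apply: openI|]; apply: open_pos; continuity.
by apply: (@open_comp _ _ (letter_opRi l) [set P | cell_ineq w P]) => // P _;
  exact: letter_opRi_continuous.
Qed.

(** On H_A the coordinate K is the positive root of Delta + S^2 - D^2, and the
    condition K > S means D^2 < Delta.  Thus H_A is a graph over the convex set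
    of the (D,S) with D^2 < Delta and S > |D|, which is star-shaped about
    (0,1). *)
Lemma H_A_connected : connected (H_A R Delta).
Proof.
pose d : R := Delta%:~R; have d0 : 0 < d by rewrite ltr0z.
pose g (Q : R3) (s : R) : R3 :=
  (Num.sqrt (d + ((1 - s) + s * coordS Q) ^+ 2 - (s * coordD Q) ^+ 2),
   s * coordD Q, (1 - s) + s * coordS Q).
have gH (Q : R3) s : H_A R Delta Q -> 0 <= s <= 1 -> H_A R Delta (g Q s).
  elim/form_ptP: Q => m n k /H_A_pt[/hyperboloid_pt hP [m0 n0 mnk]] /andP[s0 s1].
  rewrite /g /coordS /coordD /=.
  set D := s * (m - n); set S := 1 - s + s * (m + n).
  have convex_gt0 z : 0 < z -> 0 < 1 - s + s * z.
    move=> z0; move: s0; rewrite le_eqVlt => /orP[/eqP <-|s0]; first by lra.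
    by rewrite ltr_wpDl ?subr_ge0 // mulr_gt0.
  have S0 : 0 < S by apply: convex_gt0; lra.
  have am : 0 < 1 - s + s * (2 * m) by apply: convex_gt0; lra.
  have an : 0 < 1 - s + s * (2 * n) by apply: convex_gt0; lra.
  have DS : `|D| < S by rewrite ltr_norml /D /S; apply/andP; split; lra.
  have dD : D ^+ 2 < d.
    have le1 : s ^+ 2 <= 1 by rewrite expr_le1.
    have -> : d = k ^+ 2 - (m + n) ^+ 2 + (m - n) ^+ 2 by rewrite /d -hP; ring.
    rewrite /D exprMn; have : s ^+ 2 * (m - n) ^+ 2 <= (m - n) ^+ 2.
      by rewrite ler_piMl ?sqr_ge0.
    have : 0 < (k - (m + n)) * (k + (m + n)) by rewrite mulr_gt0 //; lra.
    lra.
  have KS : S < Num.sqrt (d + S ^+ 2 - D ^+ 2).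
    by rewrite -{1}(gtr0_norm S0) -sqrtr_sqr ltr_sqrt; have := exprn_gt0 2 S0; lra.
  have K0 := lt_trans S0 KS.
  split; last by [].
  split; last by rewrite /setI /= /coordD /coordS /coordK /= (gtr0_norm S0) (gtr0_norm K0).
  rewrite /hyperboloid /coordK /coordD /coordS /= sqr_sqrtr; first by rewrite -/d; ring.
  by have := sqr_ge0 S; lra.
have g1 (Q : R3) : H_A R Delta Q -> g Q 1 = Q.
  elim/form_ptP: Q => m n k /H_A_pt[/hyperboloid_pt hP [m0 n0 mnk]].
  rewrite /g /form_pt /coordS /coordD /= !mul1r subrr add0r; congr (_, _, _).
  rewrite -[RHS](@gtr0_norm _ k); last by lra.
  by rewrite -sqrtr_sqr; congr Num.sqrt; rewrite /d -hP; ring.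
have -> : H_A R Delta = \bigcup_(Q in H_A R Delta) (g Q @` `[0, 1]).
  apply/seteqP; split=> [Q HQ|P [Q HQ [s /= s01 <-]]].
    by exists Q => //; exists 1; [rewrite /= in_itv /= ler01 lexx | exact: g1].
  by apply: gH => //; rewrite in_itv /= in s01.
apply: bigcup_connected.
  exists (g (0, 0, 1) 0) => Q HQ; exists 0; first by rewrite /= in_itv /= ler01 lexx.
  by rewrite /g /coordD /coordS /=; congr (Num.sqrt _, _, _); ring.
move=> Q _; apply: connected_continuous_connected; first exact: segment_connected.
apply: continuous_subspaceT => s.
pose u (s : R) := d + ((1 - s) + s * coordS Q) ^+ 2 - (s * coordD Q) ^+ 2.
have cu : continuous u by rewrite /u; continuity.
have cD : continuous (fun s : R => s * coordD Q) by continuity.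
have cS : continuous (fun s : R => 1 - s + s * coordS Q) by continuity.
apply: (@continuous_pair _ _ _ (fun s => (Num.sqrt (u s), s * coordD Q))
  (fun s => (1 - s) + s * coordS Q)).
apply: (@continuous_pair _ _ _ (fun s => Num.sqrt (u s)) (fun s => s * coordD Q)).
- apply: (@continuous_comp _ _ _ u Num.sqrt); first exact: cu.
  exact: sqrt_continuous.
- exact: cD.
- exact: cS.
Qed.

Lemma cell_connected w : connected (cell w).
Proof.
elim: w => [|l w IH]; first exact: H_A_connected.
have -> : cell (l :: w) = letter_opR l @` cell w.
  apply/seteqP; split=> [P cP|_ [P cP <-]]; last exact/cell_cons.
  by exists (letter_opRi l P); rewrite ?letter_opRiK.
apply: connected_continuous_connected => //.
by apply: continuous_subspaceT; exact: letter_opR_continuous.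
Qed.

(** If (-x,1) is a root of the form, the real substitution (x + e c y, y) of
    determinant one keeps the form on the hyperboloid and moves the root.  With
    c the derivative 2 m x - k, whose square is Delta, the value at (-x,1)
    becomes negative for small e > 0. *)
Lemma G_A_closure_Hgen j x P : pos_generation j x -> GA P ->
  eval_neg P (ratr x) <= 0 -> closure (Hgen Delta j) P.
Proof.
move=> gx GP; rewrite le_eqVlt => /orP[/eqP q0|q0]; last first.
  by apply: subset_closure; apply/Hgen_G_A => //; exists x.
elim/form_ptP: P GP q0 => m n k GP; rewrite /eval_neg !coefE => q0 B.
have /G_A_pt[/hyperboloid_pt hP [m0 n0 k0]] := GP.
move: (q0); set y : R := ratr x; move=> {}q0.
pose c := 2 * m * y - k.
pose g (e : R) := form_pt m (n + k * (e * c) + m * (e * c) ^+ 2) (k + 2 * m * (e * c)).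
have cg : continuous g by rewrite /g; continuity.
have g0 : g 0 = form_pt m n k by rewrite /g; congr form_pt; ring.
pose V := [set Q : R3 | 0 < coef_n Q] `&` [set Q : R3 | 0 < coordK Q].
have oV : open V by apply: openI; apply: open_pos.
rewrite -g0 => Bg.
have Vg : nbhs (g 0) V by apply: open_nbhs_nbhs; split=> //; rewrite g0; split; rewrite /= !coefE.
have gBV : \forall e \near (0 : R)^'+, (B `&` V) (g e).
  have gr : g e @[e --> 0^'+] --> g 0 := cvg_at_right_filter (cg 0).
  exact: (gr _ (filterI Bg Vg)).
have [e [[Be Ve] [e0 em]]] : exists e, (B `&` V) (g e) /\ (0 < e /\ e < m^-1).
  apply: (@filter_ex _ (0 : R)^'+); near=> e.
  by split; [near: e | split; near: e; [exact: nbhs_right_gt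
    | by apply: nbhs_right_lt; rewrite invr_gt0]].
exists (g e); split=> //.
have Gg : GA (g e).
  apply/G_A_pt; split; last first.
    by move: Ve; rewrite /V /setI /g /= !coefE => -[*]; split.
  by apply/hyperboloid_pt; rewrite -hP; ring.
apply/Hgen_G_A => //; exists x => //.
rewrite /eval_neg /g !coefE -/y.
have -> : m * y ^+ 2 - (k + 2 * m * (e * c)) * y + (n + k * (e * c) + m * (e * c) ^+ 2) =
  (m * y ^+ 2 - k * y + n) - e * c ^+ 2 * (1 - e * m) by rewrite /c; ring.
rewrite q0 sub0r oppr_lt0 mulr_gt0 //; last first.
  by rewrite subr_gt0 -ltr_pdivlMr // div1r.
rewrite mulr_gt0 //; have -> : c ^+ 2 = Delta%:~R.
  by rewrite /c -hP -[RHS]addr0 -(mulr0 (4 * m)) -q0; ring.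
by rewrite ltr0z.
Unshelve. all: by end_near.
Qed.

Lemma Hgen_sub_hyperboloid j : Hgen Delta j `<=` hyperboloid (R := R) Delta.
Proof. by move=> P [p [q [_ []]]]. Qed.

(** Removing the closures of the earlier layers makes the form strictly positive
    at all directions of earlier generations; a cell meets none of these closures
    because it is open and avoids the layers themselves. *)
Lemma calH_G_A r P : (0 < r)%N -> GA P ->
  calH Delta r P <-> exists2 w, size w = r.-1 & cell w P.
Proof.
move=> r0 GP; split=> [[/Hgen_G_A-/(_ GP)[x gx qx] new]|[w sw cw]].
  apply: (cell_exists _ _ _ x) => // j y gy jr; rewrite ltNge; apply/negP => qy.
  by apply: new; exists j => //; split; [case: GP | exact: G_A_closure_Hgen qy].
have [hP wP] := (cell_ineqP w P).1 cw.
have er : (size w).+1 = r by rewrite sw prednK.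
split; first by apply/Hgen_G_A => //; rewrite -er; exact: cell_gen cw.
move=> [j /= jr [_ /(_ [set Q | cell_ineq w Q])]].
move=> /(_ (open_nbhs_nbhs (conj (cell_ineq_open w) wP)))[Q [gQ wQ]].
have cQ : cell w Q by apply/cell_ineqP; split=> //; exact: Hgen_sub_hyperboloid gQ.
have GQ := cell_sub_G_A _ _ _ _ cQ.
have [x gx] := (Hgen_G_A _ _ _ _ GQ).1 gQ; apply/negP; rewrite -leNgt ltW //.
by apply: (cell_eval_neg_gt0 _ _ _ _ _ _ cQ gx); rewrite -ltnS er.
Qed.

(** A component is connected and covered by disjoint open cells, so it stays in
    one of them; that cell is connected and in the layer, so it is not larger. *)
Lemma domain_cell C : is_domain_in Delta GA C -> exists w, C = cell w.
Proof.
move=> [CG [r [P [r0 calP eC]]]].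
have CP : C P by rewrite eC; exact: connected_component_refl.
have [w sw cw] := (calH_G_A r P r0 (CG _ CP)).1 calP.
have Ccell Q : C Q -> exists2 v, size v = r.-1 & cell v Q.
  move=> CQ; apply/calH_G_A => //; first exact: CG.
  by move: CQ; rewrite eC; exact: connected_component_sub.
exists w; apply/seteqP; split; last first.
  rewrite eC; apply: connected_component_max => //; last exact: cell_connected.
  by move=> Q cQ; apply/calH_G_A => //; [exact: cell_sub_G_A cQ | exists w].
pose others := \bigcup_(v in [set v | size v = r.-1 /\ v <> w]) [set Q | cell_ineq v Q].
have sep Q : C Q -> cell_ineq w Q <-> ~ others Q.
  move=> CQ; have [v sv cv] := Ccell Q CQ; have [hQ vQ] := (cell_ineqP v Q).1 cv.
  split=> [wQ [u [/= su uw] uQ]|no].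
    apply: uw; apply: (cell_disjoint _ _ _ _ Q); rewrite ?su //; exact/cell_ineqP.
  by have [<-//|vw] := pselect (v = w); case: no; exists v.
have cC : connected C by rewrite eC; exact: component_connected.
have <- : C `&` [set Q | cell_ineq w Q] = C.
  apply: cC; first by exists P; split=> //; exact: ((cell_ineqP w P).1 cw).2.
    by exists [set Q | cell_ineq w Q] => //; exact: cell_ineq_open.
  exists (~` others); last by apply/seteqP; split=> Q [CQ /sep h]; split=> //; exact: h.
  by apply: open_closedC; apply: bigcup_open => v _; exact: cell_ineq_open.
by move=> Q [CQ wQ]; apply/cell_ineqP; split=> //; case: (CG Q CQ).
Qed.

End Domains.

(** * Symmetries *)

(** f(y,-x), an element of the group *)
Definition turn (f : good_point) : good_point := let: (m, n, k) := f in (n, m, - k).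
(** -f(y,x), which maps orbits to orbits, preserves H^0 and exchanges A with B *)
Definition flip (f : good_point) : good_point := let: (m, n, k) := f in (- n, - m, - k).
Definition swap_letter (l : letter) : letter := if l is LA then LB else LA.

Lemma turnK : involutive turn.
Proof. by case=> -[m n] k; rewrite /turn opprK. Qed.

Lemma flipK : involutive flip.
Proof. by case=> -[m n] k; rewrite /flip !opprK. Qed.

Lemma flip_letter_op l f : flip (letter_op l f) = letter_op (swap_letter l) (flip f).
Proof. by case: l; case: f => -[m n] k; congr (_, _, _); ring. Qed.

Section Symmetries.
Variable R : realType.
Variable Delta : int.
Local Notation R3 := (R * R * R)%type.
Implicit Types P : R3.

Definition turnR P : R3 := (- coordK P, - coordD P, coordS P).
Definition flipR P : R3 := (- coordK P, coordD P, - coordS P).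

Lemma embed_turn f : embed R (turn f) = turnR (embed R f).
Proof.
case: f => -[m n] k; rewrite /embed /turn /turnR /coordK /coordD /coordS /=.
by rewrite -!rmorphN; congr (_%:~R, _%:~R, _%:~R); ring.
Qed.

Lemma embed_flip f : embed R (flip f) = flipR (embed R f).
Proof.
case: f => -[m n] k; rewrite /embed /flip /flipR /coordK /coordD /coordS /=.
by rewrite -!rmorphN; congr (_%:~R, _%:~R, _%:~R); ring.
Qed.

Definition symmetry (phi : R3 -> R3) : Prop :=
  [/\ continuous phi, involutive phi,
      forall P, hyperboloid Delta P -> hyperboloid Delta (phi P)
    & forall r P, Hgen Delta r P -> Hgen Delta r (phi P)].

Lemma rhombus_ratr (x : rat) P :
  rhombus Delta (numq x) (denq x) P <->
  hyperboloid Delta P /\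
  ((ratr x) ^+ 2 + 1) * `|coordS P| <
    2 * ratr x * coordK P + (1 - (ratr x) ^+ 2) * coordD P.
Proof.
have q0 : 0 < (denq x)%:~R :> R by rewrite ltr0z denq_gt0.
rewrite /rhombus /setI /= !(rmorphD, rmorphN, rmorphM, rmorphXn, rmorph_nat) /= /ratr.
move: ((numq x)%:~R : R) ((denq x)%:~R : R) q0 => p q q0.
have -> : ((p / q) ^+ 2 + 1) * `|coordS P| = (p ^+ 2 + q ^+ 2) * `|coordS P| / q ^+ 2.
  by field; rewrite gt_eqF.
have -> : 2 * (p / q) * coordK P + (1 - (p / q) ^+ 2) * coordD P =
  (2 * p * q * coordK P + (q ^+ 2 - p ^+ 2) * coordD P) / q ^+ 2.
  by field; rewrite gt_eqF.
by rewrite ltr_pM2r // invr_gt0 exprn_gt0.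
Qed.

Lemma turnR_hyperboloidE P : hyperboloid Delta (turnR P) = hyperboloid Delta P.
Proof. by rewrite /hyperboloid /turnR /coordK /coordD /coordS /= !sqrrN. Qed.

Lemma flipR_hyperboloidE P : hyperboloid Delta (flipR P) = hyperboloid Delta P.
Proof. by rewrite /hyperboloid /flipR /coordK /coordD /coordS /= !sqrrN. Qed.

(** The turn takes the rhombus of x to that of -1/x, and inversion exchanges the
    two maps that create the generations. *)
Lemma turn_symmetry : symmetry turnR.
Proof.
split.
- move=> P; apply: (@continuous_pair _ _ _ (fun P => (- coordK P, - coordD P)) (@coordS R)).
    apply: (@continuous_pair _ _ _ (fun P => - coordK P) (fun P => - coordD P)).
      exact: contN (@coordK_continuous R) _.
    exact: contN (@coordD_continuous R) _.
  exact: coordS_continuous.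
- by case=> -[K D] S; rewrite /turnR /coordK /coordD /coordS /= !opprK.
- by move=> P; rewrite turnR_hyperboloidE.
- move=> [|r] P [p [q [/= gpq rh]]].
    have [hP rh2] := rh; have hrP : hyperboloid Delta (turnR P) by rewrite turnR_hyperboloidE.
    case: gpq rh2 => -[-> ->] rh2; [exists 1, 0 | exists 0, 1]; (split; [by [left | right]|]);
      split=> //; move: rh2; rewrite /turnR /coordK /coordD /coordS /=;
      rewrite ?expr0n ?expr1n ?mulr0 ?mul0r ?mulr1 ?subr0 ?sub0r ?addr0 ?add0r ?mul1r ?rmorphN /=; lra.
  move: gpq => [x [gx ep eq]]; exists (numq (- x^-1)), (denq (- x^-1)).
  split; first by exists (- x^-1); rewrite normrN normfV; split=> //; exact: pos_generationI.
  have [_] := pos_generation_gt0 _ _ gx; rewrite normr_gt0 => x0.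
  move: rh; rewrite ep eq => /rhombus_ratr[hP rh].
  apply/rhombus_ratr; split; first by rewrite turnR_hyperboloidE.
  rewrite rmorphN fmorphV /turnR /coordK /coordD /coordS /=.
  have : ratr x != 0 :> R by rewrite fmorph_eq0.
  move: (ratr x : R) rh => y rh y0.
  have y2 : 0 < y ^+ 2 by rewrite exprn_even_gt0.
  rewrite -(ltr_pM2r y2).
  rewrite [X in X < _](_ : _ = (y ^+ 2 + 1) * `|P.2|); last by field.
  rewrite [X in _ < X](_ : _ = 2 * y * P.1.1 + (1 - y ^+ 2) * P.1.2); last by field.
  exact: rh.
Qed.

(** The flip takes the rhombus of x to that of -x. *)
Lemma flip_symmetry : symmetry flipR.
Proof.
split.
- move=> P; apply: (@continuous_pair _ _ _ (fun P => (- coordK P, coordD P)) (fun P => - coordS P)).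
    apply: (@continuous_pair _ _ _ (fun P => - coordK P) (@coordD R)).
      exact: contN (@coordK_continuous R) _.
    exact: coordD_continuous.
  exact: contN (@coordS_continuous R) _.
- by case=> -[K D] S; rewrite /flipR /coordK /coordD /coordS /= !opprK.
- by move=> P; rewrite flipR_hyperboloidE.
- move=> [|r] P [p [q [/= gpq rh]]].
    exists p, q; split=> //; have [hP rh2] := rh; split; first by rewrite flipR_hyperboloidE.
    by case: gpq rh2 => -[-> ->]; rewrite /flipR /coordK /coordD /coordS /= normrN;
      rewrite ?mulr0 ?mul0r.
  move: gpq => [x [gx ep eq]]; exists (numq (- x)), (denq (- x)).
  split; first by exists (- x); rewrite normrN.
  move: rh; rewrite ep eq => /rhombus_ratr[hP rh].
  apply/rhombus_ratr; split; first by rewrite flipR_hyperboloidE.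
  by rewrite rmorphN /flipR /coordK /coordD /coordS /= normrN sqrrN !mulrN mulNr opprK.
Qed.

Lemma closure_symmetry phi r P : symmetry phi ->
  closure (Hgen Delta r) P -> closure (Hgen Delta r) (phi P).
Proof.
move=> [cphi _ _ Hphi] clP B nB; have [Q [gQ BQ]] := clP _ (cphi P _ nB).
by exists (phi Q); split=> //; exact: Hphi.
Qed.

Lemma calH_symmetry phi r P : symmetry phi -> calH Delta r P -> calH Delta r (phi P).
Proof.
move=> sphi; have [_ phiK hphi Hphi] := sphi.
move=> [gP new]; split; first exact: Hphi.
move=> [j jr [hP clP]]; apply: new; exists j => //.
by rewrite -[P]phiK; split; [exact: hphi | exact: closure_symmetry].
Qed.

Lemma component_symmetry phi r P : symmetry phi ->
  phi @` connected_component (calH Delta r) P `<=`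
    connected_component (calH Delta r) (phi P).
Proof.
move=> sphi; have [cphi _ _ _] := sphi.
have [calP|nP] := pselect (calH Delta r P); last first.
  by rewrite connected_component_out // image_set0.
apply: connected_component_max.
- by exists P => //; exact: connected_component_refl.
- by move=> _ [Q /connected_component_sub cQ <-]; exact: calH_symmetry.
- apply: connected_continuous_connected; first exact: component_connected.
  exact: continuous_subspaceT.
Qed.

Lemma domain_symmetry phi (G C : set R3) : symmetry phi ->
  is_domain_in Delta G C -> is_domain_in Delta (phi @^-1` G) (phi @^-1` C).
Proof.
move=> sphi [CG [r [P [r0 calP eC]]]]; have [_ phiK _ _] := sphi.
split=> [Q /CG //|]; exists r, (phi P); split=> //; first exact: calH_symmetry.
rewrite eC; apply/seteqP; split=> Q /= cQ.
  by rewrite -[Q]phiK; apply: component_symmetry => //; exists (phi Q).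
by rewrite -[P]phiK; apply: component_symmetry => //; exists Q.
Qed.

Lemma has_points_symmetry (psi : good_point -> good_point) (phi : R3 -> R3)
    (O : set good_point) (C : set R3) N :
  involutive psi -> (forall f, embed R (psi f) = phi (embed R f)) ->
  has_points (psi @^-1` O) (phi @^-1` C) N -> has_points O C N.
Proof.
rewrite /has_points => psiK psiE; apply: card_eq_trans.
have -> : [set f | O f /\ C (embed R f)] =
    psi @` [set f | (psi @^-1` O) f /\ (phi @^-1` C) (embed R f)].
  apply/seteqP; split=> [f [Of Cf]|_ [f [Of Cf] <-]].
    by exists (psi f); rewrite ?psiK //= -psiE psiK.
  by split=> //; rewrite psiE.
by apply: inj_card_eq => f g _ _; exact: inv_inj.
Qed.

Local Ltac regions :=
  rewrite predeqE => P /=; rewrite /setI /= ?turnR_hyperboloidE ?flipR_hyperboloidE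
    ?/setI /= /turnR /flipR /coordK /coordD /coordS /= ?normrN
    ?oppr_lt0 ?oppr_gt0 ?ltrN2.

Lemma turnR_G_Abar : turnR @^-1` G_Abar R Delta = G_A R Delta.
Proof. by rewrite /G_Abar /G_A; regions. Qed.

Lemma turnR_G_Bbar : turnR @^-1` G_Bbar R Delta = G_B R Delta.
Proof. by rewrite /G_Bbar /G_B; regions. Qed.

Lemma flipR_G_B : flipR @^-1` G_B R Delta = G_A R Delta.
Proof. by rewrite /G_B /G_A; regions. Qed.

Lemma turnR_H_Abar : turnR @^-1` H_Abar R Delta = H_A R Delta.
Proof. by rewrite /H_Abar /H_A /H_outer; regions. Qed.

Lemma turnR_H_Bbar : turnR @^-1` H_Bbar R Delta = H_B R Delta.
Proof. by rewrite /H_Bbar /H_B /H_outer; regions. Qed.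

Lemma flipR_H_B : flipR @^-1` H_B R Delta = H_A R Delta.
Proof. by rewrite /H_B /H_A /H_outer; regions. Qed.

End Symmetries.

(** * Counting the points of an orbit *)

Section Counting.
Variable R : realType.
Variable Delta : int.

Lemma card_tuple_letters (t : nat) (w : t.-tuple letter) (a : pred letter) :
  ([set i : 'I_t | a (tnth w i)] #= `I_(count a w))%card.
Proof.
have -> : count a w = #|[pred i | a (tnth w i)]|.
  by rewrite cardE /enum_mem size_filter -enumT -[in LHS](map_tnth_enum w) count_map.
apply: card_eq_trans (_ : [set: 'I_#|[pred i | a (tnth w i)]|] #= _)%card; last first.
  by rewrite card_eq_sym card_II.
have -> : [set i : 'I_t | a (tnth w i)] =
    enum_val (A := [pred i | a (tnth w i)]) @` [set: 'I_#|[pred i | a (tnth w i)]|].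
  apply/seteqP; split=> [i /= ai|_ [j _ <-]]; last exact: (enum_valP j).
  by exists (enum_rank_in (A := [pred i | a (tnth w i)]) ai i); rewrite ?enum_rankK_in.
by apply: inj_card_eq => i j _ _; exact: enum_val_inj.
Qed.

Lemma H0_embed (f : good_point) :
  H0 (R := R) Delta (embed R f) <-> disc f = Delta /\ straddles f.
Proof.
case: f => -[m n] k; rewrite embedE H0_pt hyperboloid_pt /straddles /= ltr0z ltrz0.
have -> : k%:~R ^+ 2 - 4 * m%:~R * n%:~R = (k ^+ 2 - 4 * m * n)%:~R :> R.
  by rewrite !(rmorphD, rmorphN, rmorphM, rmorphXn, rmorph_nat).
by split=> -[h1 h2]; split=> //; [apply: (@intr_inj R) | rewrite h1].
Qed.

Lemma H_A_embed (m n k : int) :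
  H_A R Delta (embed R (m, n, k)) <->
  disc (m, n, k) = Delta /\ [/\ 0 < m, 0 < n & m + n < k].
Proof.
rewrite embedE H_A_pt hyperboloid_pt /= !ltr0z -rmorphD ltr_int.
have -> : k%:~R ^+ 2 - 4 * m%:~R * n%:~R = (k ^+ 2 - 4 * m * n)%:~R :> R.
  by rewrite !(rmorphD, rmorphN, rmorphM, rmorphXn, rmorph_nat).
by split=> -[h1 h2]; split=> //; [apply: (@intr_inj R) | rewrite h1].
Qed.

Definition stable_orbit (O : set good_point) : Prop :=
  [/\ forall f, O f -> disc f = Delta,
      forall l f, O (letter_op l f) <-> O f & forall f, O (turn f) <-> O f].

(** A cycle in H^0 that runs through all points of O in H^0. *)
Definition traverses (O : set good_point) (t : nat)
    (f : 'I_t -> good_point) (w : t.-tuple letter) : Prop :=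
  [/\ is_cycle f w, forall i, O (f i), forall i, straddles (f i)
    & forall g, O g -> straddles g -> exists i, g = f i].

(** A is a bijection from the points of the cycle that are followed by B onto
    the points of O in H_A: for f in H^0, A f has m > 0 and k - m - n = - n(f) > 0,
    and it is in H_A exactly when its n is positive, that is when A f is not in
    H^0. *)
Lemma H_A_count O t (f : 'I_t -> good_point) w :
  stable_orbit O -> traverses O t f w -> has_points O (H_A R Delta) (count is_B w).
Proof.
move=> [dO OL _] [[_ fI fS] Of sf cover].
apply: card_eq_trans (card_tuple_letters t w is_B).
have -> : [set g | O g /\ H_A R Delta (embed R g)] =
    (opA \o f) @` [set i | is_B (tnth w i)].
  apply/seteqP; split=> [[[m n] k] [Og /H_A_embed[dg [m0 n0 mnk]]]|_ [i wi <-]].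
    pose g := (m, m + n - k, k - 2 * m) : good_point.
    have Ag : opA g = (m, n, k) by congr (_, _, _); lia.
    have [i fi] : exists i, g = f i.
      apply: cover; first by apply/(OL LA); rewrite [letter_op _ _]Ag.
      by split=> /=; lia.
    exists i; last by rewrite /= -fi.
    have := fS i; rewrite /= -fi; case: (tnth w i) => //= e.
    by have := sf (ordS i); rewrite e => -[_] /=; lia.
  have := fS i; have := sf (ordS i); have := sf i; have := Of i; move: wi => /=.
  case: (tnth w i) (f i) => // -[[m n] k] _ Ofi [/= m1 n0] s e.
  move: s; rewrite e => -[/= m0 _].
  split; first exact: ((OL LA _).2 Ofi).
  have dA := dO _ ((OL LA _).2 Ofi).
  by apply/H_A_embed; split=> //; split; lia.
by apply: inj_card_eq => i j _ _ /opA_inj/fI.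
Qed.

Lemma has_points_cell O w N :
  (forall l f, O (letter_op l f) <-> O f) ->
  has_points O (H_A R Delta) N -> has_points O (cell R Delta w) N.
Proof.
move=> OL HN; elim: w => [//|l w IH]; apply: card_eq_trans IH.
have -> : [set f | O f /\ cell R Delta (l :: w) (embed R f)] =
    letter_op l @` [set f | O f /\ cell R Delta w (embed R f)].
  apply/seteqP; split=> [f [Of cf]|_ [f [Of cf] <-]]; last first.
    by split; [exact/OL | rewrite embed_letter_op; exact/cell_cons].
  have [g gf] : exists g, letter_op l g = f.
    case: l f {Of cf} => -[[m n] k].
      by exists (m, n - m - (k - 2 * m), k - 2 * m); congr (_, _, _); ring.
    by exists (m - n - (k - 2 * n), n, k - 2 * n); congr (_, _, _); ring.
  exists g => //; split; first by apply/(OL l); rewrite gf.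
  by move: cf; rewrite -gf embed_letter_op => /cell_cons.
by apply: inj_card_eq => f g _ _; exact: letter_op_inj.
Qed.

Lemma has_points_turn O (C : set (R * R * R)) N : stable_orbit O ->
  has_points O (turnR R @^-1` C) N -> has_points O C N.
Proof.
move=> [_ _ Or] h; apply: (has_points_symmetry R turn (turnR R)) => //.
- exact: turnK.
- exact: embed_turn.
- by rewrite (_ : turn @^-1` O = O) //; apply/seteqP; split=> f /Or.
Qed.

Lemma upper_counts (Delta_gt0 : 0 < Delta) O t (f : 'I_t -> good_point) w :
  stable_orbit O -> traverses O t f w ->
  [/\ has_points O (H_A R Delta) (count is_B w),
       has_points O (H_Abar R Delta) (count is_B w),
       (forall C, is_domain_in Delta (G_A R Delta) C -> has_points O C (count is_B w))
     & (forall C, is_domain_in Delta (G_Abar R Delta) C -> has_points O C (count is_B w))].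
Proof.
move=> Oinv Of; have HN := H_A_count O t f w Oinv Of; have [_ OL _] := Oinv.
have HC C : is_domain_in Delta (G_A R Delta) C -> has_points O C (count is_B w).
  by move=> /(domain_cell _ _ Delta_gt0)[v ->]; exact: has_points_cell.
split=> // [|C dC]; apply: has_points_turn => //; first by rewrite turnR_H_Abar.
by apply: HC; rewrite -turnR_G_Abar; apply: domain_symmetry => //; exact: turn_symmetry.
Qed.

Lemma flip_stable O : stable_orbit O -> stable_orbit (flip @^-1` O).
Proof.
move=> [dO OL Or]; split=> [f /dO <-|l f|f] /=.
- by case: f => -[m n] k; rewrite /disc /flip; ring.
- by rewrite flip_letter_op.
- by rewrite (_ : flip (turn f) = turn (flip f)) //; case: f => -[m n] k.
Qed.

Lemma flip_straddles f : straddles (flip f) <-> straddles f.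
Proof. by case: f => -[m n] k; rewrite /straddles /= oppr_gt0 oppr_lt0; split=> -[]. Qed.

Lemma flip_traverses O t (f : 'I_t -> good_point) w : traverses O t f w ->
  traverses (flip @^-1` O) t (flip \o f) [tuple of map swap_letter w].
Proof.
move=> [[t1 fI fS] Of sf cover]; split.
- split=> // [|i]; first by apply: inj_comp fI; exact: inv_inj flipK.
  by rewrite /= fS flip_letter_op tnth_map.
- by move=> i; rewrite /= flipK.
- by move=> i; exact/flip_straddles.
- move=> g Og /flip_straddles sg; have [i fi] := cover _ Og sg.
  by exists i; rewrite /= -fi flipK.
Qed.

(** Apply the counts for G_A to the flipped orbit, whose cycle has its letters
    exchanged. *)
Lemma lower_counts (Delta_gt0 : 0 < Delta) O t (f : 'I_t -> good_point) w :
  stable_orbit O -> traverses O t f w ->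
  [/\ has_points O (H_B R Delta) (count is_A w),
       has_points O (H_Bbar R Delta) (count is_A w),
       (forall C, is_domain_in Delta (G_B R Delta) C -> has_points O C (count is_A w))
     & (forall C, is_domain_in Delta (G_Bbar R Delta) C -> has_points O C (count is_A w))].
Proof.
move=> Oinv Of.
have [HN _ HC _] := upper_counts Delta_gt0 _ _ _ _ (flip_stable _ Oinv) (flip_traverses _ _ _ _ Of).
have cE : count is_B [tuple of map swap_letter w] = count is_A w.
  by rewrite count_map; apply: eq_count => -[].
rewrite {}cE in HN HC.
have HBN : has_points O (H_B R Delta) (count is_A w).
  apply: (has_points_symmetry R flip (flipR R)); [exact: flipK | exact: embed_flip |].
  by rewrite flipR_H_B.
have HBC C : is_domain_in Delta (G_B R Delta) C -> has_points O C (count is_A w).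
  move=> dC; apply: (has_points_symmetry R flip (flipR R));
    [exact: flipK | exact: embed_flip | apply: HC].
  by rewrite -flipR_G_B; apply: domain_symmetry => //; exact: flip_symmetry.
split=> // [|C dC]; apply: has_points_turn => //; first by rewrite turnR_H_Bbar.
by apply: HBC; rewrite -turnR_G_Bbar; apply: domain_symmetry => //; exact: turn_symmetry.
Qed.

Lemma orbit_subst f g a b c d : a * d - b * c = 1 ->
  orbit_of f (subst_form a b c d g) <-> orbit_of f g.
Proof.
have mono (x y z u : int) h : x * u - y * z = 1 ->
    orbit_of f h -> orbit_of f (subst_form x y z u h).
  move=> e /orbit_ofP[x' [y' [z' [u' [e' ->]]]]]; apply/orbit_ofP.
  rewrite subst_comp; do 4 eexists; split; last reflexivity.
  by transitivity ((x' * u' - y' * z') * (x * u - y * z)); [ring | rewrite e e'].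
move=> e; split=> [h|]; last exact: mono.
by rewrite -(subst_inv a b c d g e); apply: mono h; rewrite -e; ring.
Qed.

Lemma orbit_stable f : disc f = Delta -> stable_orbit (orbit_of f).
Proof.
move=> df; split.
- by move=> g /orbit_ofP[a [b [c [d [e ->]]]]]; rewrite disc_subst.
- by case=> g /=; rewrite ?opAE ?opBE; exact: orbit_subst.
- move=> g; rewrite (_ : turn g = subst_form 0 1 (- 1) 0 g); first exact: orbit_subst.
  by case: g => -[m n] k; congr (_, _, _); ring.
Qed.

(** The cycle is closed under steps in both directions: of A and B, only one
    leads a given point of H^0 into H^0, and only one leads into a given point of
    H^0 from H^0, so each such step is a step of the cycle. *)
Lemma cycle_traverses (O : set good_point) t (f : 'I_t -> good_point) w :
  (~ exists s : int, Delta = s ^+ 2) -> is_orbit Delta O ->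
  is_cycle f w -> (forall i, O (f i)) -> (forall i, H0 (R := R) Delta (embed R (f i))) ->
  traverses O t f w.
Proof.
move=> nsq [f0 df0 eO] cyc Of Hf; have [t1 fI fS] := cyc.
have sf i : straddles (f i) by have /H0_embed[] := Hf i.
have df i : disc (f i) = Delta by have /H0_embed[] := Hf i.
split=> // g Og sg.
have i0 : 'I_t by exact: (Ordinal (ltnW t1)).
suff : range f g by case=> i _ <-; exists i.
apply: (straddling_orbit_mem (range f) Delta nsq _ _ _ _ _ (f i0)) => //.
- by move=> _ [i _ <-].
- move=> _ [i _ <-] sA; exists (ordS i) => //; rewrite fS.
  have := sf (ordS i); rewrite fS; case: (tnth w i) => //= sB.
  exfalso; move: sA sB; case: (f i) => -[m n] k [/= _ a] [/= b _].
  by lia.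
- move=> _ [i _ <-] sB; exists (ordS i) => //; rewrite fS.
  have := sf (ordS i); rewrite fS; case: (tnth w i) => //= sA.
  exfalso; move: sA sB; case: (f i) => -[m n] k [/= _ a] [/= b _].
  by lia.
- move=> h sh dh [i _ fi].
  have [j ji] : exists j, ordS j = i by exists (ord_pred i); rewrite ord_predK.
  have := sf j; have := fS j; rewrite ji fi; case: (tnth w j) => /= e sj.
    by exists j => //; apply: opA_inj.
  exfalso; move: sh sj e; case: h {fi dh} => -[m n] k; case: (f j) => -[m' n'] k'.
  by move=> [/= h1 h2] [/= h3 h4] [*]; lia.
- move=> h sh dh [i _ fi].
  have [j ji] : exists j, ordS j = i by exists (ord_pred i); rewrite ord_predK.
  have := sf j; have := fS j; rewrite ji fi; case: (tnth w j) => /= e sj.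
    exfalso; move: sh sj e; case: h {fi dh} => -[m n] k; case: (f j) => -[m' n'] k'.
    by move=> [/= h1 h2] [/= h3 h4] [*]; lia.
  by exists j => //; apply: opB_inj.
- by rewrite eO in Og; apply: orbit_of_trans Og; have := Of i0; rewrite eO.
Qed.

End Counting.

Theorem theorem4p13 (R : realType) (Delta : int)
    (Delta_gt0 : 0 < Delta)
    (Delta_nonsquare : ~ exists s : int, Delta = s ^+ 2)
    (O : set good_point) (O_orbit : is_orbit Delta O)
    (t : nat) (T : good_point -> good_point)
    (T_cycle : cycle_operator R Delta O t T)
    (tA tB : nat) :
  (t = (tA + tB)%N /\ is_product tA tB T) <->
  ([/\ has_points O (H_A R Delta) tB,
       has_points O (H_Abar R Delta) tB,
       (forall C : set (R * R * R),
          is_domain_in Delta (G_A R Delta) C -> has_points O C tB)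
     & (forall C : set (R * R * R),
          is_domain_in Delta (G_Abar R Delta) C -> has_points O C tB)]
   /\
   [/\ has_points O (H_B R Delta) tA,
       has_points O (H_Bbar R Delta) tA,
       (forall C : set (R * R * R),
          is_domain_in Delta (G_B R Delta) C -> has_points O C tA)
     & (forall C : set (R * R * R),
          is_domain_in Delta (G_Bbar R Delta) C -> has_points O C tA)]).
Proof.
have [f [w [cyc Of Hf Tw]]] := T_cycle.
have trav := cycle_traverses R Delta O t f w Delta_nonsquare O_orbit cyc Of Hf.
have Oinv : stable_orbit Delta O.
  by have [f0 df0 ->] := O_orbit; exact: orbit_stable.
have up := upper_counts R Delta Delta_gt0 O t f w Oinv trav.
have low := lower_counts R Delta Delta_gt0 O t f w Oinv trav.
split=> [[_ [v [<- <- Tv]]]|[[HB _ _ _] [HA _ _ _]]].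
  have -> : v = w by apply: word_op_inj => g; rewrite -Tv Tw.
  by split.
have same_count C a b : has_points (R := R) O C a -> has_points O C b -> a = b.
  by move=> ha hb; apply/card_eq_II; apply: card_eq_trans hb; rewrite card_eq_sym.
have [[HB' _ _ _] [HA' _ _ _]] := (up, low).
have eB := same_count _ _ _ HB' HB; have eA := same_count _ _ _ HA' HA.
split; last by exists w.
have sw := size_tuple w; rewrite -eA -eB -[LHS]sw -(count_predC is_A w).
by congr (_ + _)%N; apply: eq_count => -[].
Qed.
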